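(* Let $f:\mathbb{R}^n\to\mathbb{R}\cup\{+\infty\}$ be proper, convex and lower semicontinuous, and let $g:\mathbb{R}^n\to\mathbb{R}$ be a (possibly nonconvex) Fréchet differentiable function whose gradient is $\beta$-Lipschitz continuous for some $\beta\ge 0$. Suppose that $f+g$ is bounded from below and that $\eta>0$ satisfies $\eta\beta(3+\eta\beta)<1$. For $x_0\in\mathbb{R}^n$, let $x\in C^1([0,+\infty),\mathbb{R}^n)$ be the unique global solution of $$\dot x(t)+x(t)=\operatorname{prox}_{\eta f}\big(x(t)-\eta\nabla g(x(t))\big),\qquad x(0)=x_0.$$ Suppose that $x$ is bounded and that $f+g$ is semi-algebraic. Then: (a) $\dot x\in L^1([0,+\infty);\mathbb{R}^n)$; (b) there exists $\overline x\in\operatorname{crit}(f+g)$ such that $\lim_{t\to+\infty}x(t)=\overline x$.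
   Context: $\mathbb{R}^n$ carries the Euclidean inner product and norm. The proximal point operator is $\operatorname{prox}_{\eta f}(y)=\operatorname{argmin}_{u\in\mathbb{R}^n}\{f(u)+\frac{1}{2\eta}\|u-y\|^2\}$; it is nonexpansive, and the dynamical system has a unique global $C^1$ solution by the Cauchy–Lipschitz theorem. For a proper lower semicontinuous $h:\mathbb{R}^n\to\mathbb{R}\cup\{+\infty\}$ with $\operatorname{dom}h=\{x:h(x)<+\infty\}$, the Fréchet subdifferential at $x\in\operatorname{dom}h$ is $\hat\partial h(x)=\{v:\liminf_{y\to x}\frac{h(y)-h(x)-\langle v,y-x\rangle}{\|y-x\|}\ge 0\}$, and the limiting (Mordukhovich) subdifferential is $\partial h(x)=\{v:\exists x_k\to x,\ h(x_k)\to h(x),\ \exists v_k\in\hat\partial h(x_k),\ v_k\to v\}$; both are empty for $x\notin\operatorname{dom}h$. $\operatorname{crit}(h)=\{x:0\in\partial h(x)\}$. A function $h:\mathbb{R}^n\to\mathbb{R}\cup\{+\infty\}$ is semi-algebraic if its graph $\{(x,r)\in\mathbb{R}^n\times\mathbb{R}:h(x)=r\}$ is a semi-algebraic subset of $\mathbb{R}^{n+1}$ (a finite union of sets defined by finitely many polynomial equalities and strict inequalities). *)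

(* Defs.v *)
From HB Require Import structures.
From mathcomp Require Import all_boot all_order all_algebra.
From mathcomp Require Import all_classical all_reals all_analysis.
From mathcomp Require mpoly.

Set Implicit Arguments.
Unset Strict Implicit.
Unset Printing Implicit Defensive.

Import Order.TTheory GRing.Theory Num.Theory.
Import numFieldNormedType.Exports.

Local Open Scope classical_set_scope.
Local Open Scope ring_scope.

(** R^n is ['rV[R]_n].  The library norm [`|x|] on ['rV[R]_n] is the sup norm.
    It is used only through notions that do not depend on the choice of an
    equivalent norm (convergence, continuity, semicontinuity, Fréchet
    differentiability); everything metric goes through [enorm]. *)

Section Euclidean.
Context {R : realType} {n : nat}.
Implicit Types x y : 'rV[R]_n.

Definition edot x y : R := \sum_(i < n) x 0 i * y 0 i.

Definition enorm x : R := Num.sqrt (edot x x).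

(** When [g] is differentiable at [x], the Riesz representative for [edot] of
    its differential. *)
Definition grad (g : 'rV[R]_n -> R) x : 'rV[R]_n :=
  \row_(i < n) 'd g x (delta_mx 0 i).

End Euclidean.

Section ExtendedValued.
Context {R : realType} {n : nat}.
Implicit Types (h : 'rV[R]_n -> \bar R) (x y u v : 'rV[R]_n).
Local Open Scope ereal_scope.

Definition edom h : set 'rV[R]_n := [set x | h x < +oo].

(** Includes that [h] takes its values in R ∪ {+oo}. *)
Definition eproper h : Prop := (forall x, h x != -oo) /\ edom h !=set0.

(** The endpoints of [[0, 1]] are harmless since [0 * +oo = 0]. *)
Definition econvex h : Prop := forall x y (t : R), (0 <= t <= 1)%R ->
  h (t *: x + (1 - t) *: y)%R <= t%:E * h x + (1 - t)%:E * h y.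

Definition bounded_below h : Prop := exists m : R, forall x, m%:E <= h x.

Definition argmin h : set 'rV[R]_n := [set u | forall w, h u <= h w].

(** [prox eta f y] is meaningful when the [argmin] is a singleton, as it is for
    [f] proper, convex and lower semicontinuous and [eta > 0]. *)
Definition prox (eta : R) (f : 'rV[R]_n -> \bar R) y : 'rV[R]_n :=
  get (argmin (fun u => f u + ((2 * eta)^-1 * enorm (u - y) ^+ 2)%R%:E)).

Definition frechet_subdiff h x : set 'rV[R]_n :=
  [set v | edom h x /\
    0 <= limf_einf (fun y => (h y - h x - (edot v (y - x))%:E)
                             * ((enorm (y - x))^-1)%R%:E) x^'].

Definition limiting_subdiff h x : set 'rV[R]_n :=
  [set v | edom h x /\
    exists x_ v_ : nat -> 'rV[R]_n,
      [/\ x_ @ \oo --> x, h \o x_ @ \oo --> h x,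
          forall k, frechet_subdiff h (x_ k) (v_ k) & v_ @ \oo --> v]].

Definition crit h : set 'rV[R]_n := [set x | limiting_subdiff h x 0%R].

End ExtendedValued.

Section SemiAlgebraic.
Context {R : realType}.

(** A pair [(P, Q)] in the list encodes the set of the [z] with [p z = 0] for
    all [p] in [P] and [q z > 0] for all [q] in [Q]; the list encodes the union
    of these sets. *)
Definition semialgebraic_set (m : nat) (A : set 'rV[R]_m) : Prop :=
  exists s : seq (seq (mpoly.mpoly m R) * seq (mpoly.mpoly m R)),
    A = [set z : 'rV[R]_m |
          has (fun c => all (fun p => mpoly.meval (z 0) p == 0) c.1 &&
                        all (fun q => 0 < mpoly.meval (z 0) q) c.2) s].

(** Points of the graph have a real second component, so none lies over [x] when
    [h x] is infinite. *)
Definition finite_graph (n : nat) (h : 'rV[R]_n -> \bar R) : set 'rV[R]_(n + 1) :=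
  [set z | h (lsubmx z) = (rsubmx z 0 0)%:E].

Definition semialgebraic_fun (n : nat) (h : 'rV[R]_n -> \bar R) : Prop :=
  semialgebraic_set (finite_graph h).

End SemiAlgebraic.

Section HalfLine.
Context {R : realType} {n : nat}.
Implicit Types x : R -> 'rV[R]_n.

(** Derivative of [x] at [t] relative to [[0, +oo[]: two-sided for [t > 0], and
    one-sided at [0].  The values of [x] at negative times are irrelevant. *)
Definition quotient0y x (t s : R) : 'rV[R]_n := (s - t)^-1 *: (x s - x t).

Definition derivable0y x (t : R) : Prop :=
  cvg (quotient0y x t s @[s --> within `[0, +oo[ t^']).

Definition derive0y x (t : R) : 'rV[R]_n :=
  lim (quotient0y x t s @[s --> within `[0, +oo[ t^']).

Definition C1_0y x : Prop :=
  (forall t, 0 <= t -> derivable0y x t) /\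
  {within `[0, +oo[, continuous (derive0y x)}.

Definition L1_0y x : Prop :=
  (forall i, measurable_fun (`[0, +oo[ : set R) (fun t => x t 0 i)) /\
  lebesgue_measure.-integrable (`[0, +oo[ : set R) (fun t => (enorm (x t))%:E).

End HalfLine.

(* Main.v *)
(** Put [p t = prox (x t - eta grad g (x t))], [v t = p t - x t] (the velocity) and
    [F (u, y) = f u + g u + |u - y|^2 / (2 eta)].  Optimality of [p t] and the Lipschitz
    gradient of [g] give [F (u, y) >= F (p t, x t) + (linear term) - beta |u - p t|^2],
    where the linear term has slope at most [C |v t|].  Taken at another point of the
    trajectory, this shows that the energy [H t = F (p t, x t)] satisfies
    [H t - H s >= al |v t|^2 (s - t) - O ((s - t)^2)].

    For the Kurdyka-Lojasiewicz inequality, choose, for small [r > 0], a point [u r] at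
    level [inf H + r] of [F] with the smallest slope.  Quantifier elimination makes the
    coordinates of [u r] semialgebraic functions of [r], hence monotone near [0+]; their
    total variation [phi] satisfies
    [r - s <= slope * (phi r - phi s) + O ((phi r - phi s)^2)].
    At [r = H t - inf H] the slope is at most [C |v t|], so [phi (H t - inf H)]
    decreases at rate at least [al / C |v t|].  Hence the trajectory has finite length
    and converges; its limit is critical because the subgradients at [p t] are bounded
    by a multiple of [|v t|], which tends to [0].  All estimates are integrated by
    telescoping, since a function with [G s - G t <= K (s - t)^2] for [t < s] is
    nonincreasing: neither [H] nor [phi] needs to be differentiable, or even
    continuous. *)

Require Import Defs.
From HB Require Import structures.
From mathcomp Require Import all_boot all_order all_algebra.
From mathcomp Require Import all_classical all_reals all_analysis.
From mathcomp Require Import measurable_realfun ring lra zify.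
From mathcomp Require mpoly polyrcf ordered_qelim qe_rcf.
Set Implicit Arguments.
Unset Strict Implicit.
Unset Printing Implicit Defensive.
Import Order.TTheory GRing.Theory Num.Theory.
Import numFieldNormedType.Exports.
Local Open Scope classical_set_scope.
Local Open Scope ring_scope.

(** * Semialgebraic predicates *)

(** The initial point is arbitrary, so [x t] may lie outside the domain of [f]; only [p t] is known
    to carry a finite value. Hence an energy on pairs, with [f + g] evaluated at [p t] and the
    distance to [x t] as a penalty. Semialgebraicity is given for [f + g] alone: [f], [g], [grad g],
    the proximal operator and the trajectory may all fail to be definable. Definable formulas can
    therefore mention only values of [F], which adds a polynomial to [f + g]; this is why the slope
    is expressed by inequalities between such values. Fixing the curvature constant in advance makes
    the set of pairs (slope, point) at a given level closed, so the smallest slope in a bounded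
    region is attained although [F] is merely lower semicontinuous. The price is a quadratic error,
    which telescoping absorbs as long as the speed stays away from 0. A Gronwall bound ensures this
    on each compact interval, and the resulting length estimate does not involve the lower bound on
    the speed. *)

Section SemialgebraicPredicates.
Context {R : rcfType}.
Implicit Types (E : nat -> R) (F G : (nat -> R) -> R) (P Q : (nat -> R) -> Prop).

(** Predicates and functions depend on an assignment [E] of real values to the
    variables of index [0, 1, 2, ...]; quantifiers bind variable [0] and shift the
    others. *)
Inductive polyfun : ((nat -> R) -> R) -> Prop :=
| polyfun_cst c : polyfun (fun=> c)
| polyfun_var i : polyfun (fun E => E i)
| polyfun_add F G : polyfun F -> polyfun G -> polyfun (fun E => F E + G E)
| polyfun_mul F G : polyfun F -> polyfun G -> polyfun (fun E => F E * G E).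

Inductive sa : ((nat -> R) -> Prop) -> Prop :=
| sa_pos F : polyfun F -> sa (fun E => 0 < F E)
| sa_not P : sa P -> sa (fun E => ~ P E)
| sa_and P Q : sa P -> sa Q -> sa (fun E => P E /\ Q E).

Lemma polyfun_ext F G : F =1 G -> polyfun F -> polyfun G.
Proof. by move=> /funext ->. Qed.

Lemma polyfun_opp F : polyfun F -> polyfun (fun E => - F E).
Proof.
move=> pF; apply: (@polyfun_ext (fun E => -1 * F E)) => [E|].
  by rewrite mulN1r.
by apply: polyfun_mul => //; apply: polyfun_cst.
Qed.

Lemma polyfun_sub F G : polyfun F -> polyfun G -> polyfun (fun E => F E - G E).
Proof. by move=> pF pG; apply: polyfun_add => //; apply: polyfun_opp. Qed.

Lemma polyfun_sum (I : Type) (r : seq I) (F : I -> (nat -> R) -> R) :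
  (forall i, polyfun (F i)) -> polyfun (fun E => \sum_(i <- r) F i E).
Proof.
move=> pF; elim: r => [|i r IH].
  by apply: (@polyfun_ext (fun=> 0)) (polyfun_cst 0) => E; rewrite big_nil.
apply: (@polyfun_ext (fun E => F i E + \sum_(j <- r) F j E)).
  by move=> E; rewrite big_cons.
exact: polyfun_add.
Qed.

Lemma polyfun_prod (I : Type) (r : seq I) (F : I -> (nat -> R) -> R) :
  (forall i, polyfun (F i)) -> polyfun (fun E => \prod_(i <- r) F i E).
Proof.
move=> pF; elim: r => [|i r IH].
  by apply: (@polyfun_ext (fun=> 1)) (polyfun_cst 1) => E; rewrite big_nil.
apply: (@polyfun_ext (fun E => F i E * \prod_(j <- r) F j E)).
  by move=> E; rewrite big_cons.
exact: polyfun_mul.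
Qed.

Lemma polyfun_exp F n : polyfun F -> polyfun (fun E => F E ^+ n).
Proof.
move=> pF; elim: n => [|n IH]; first exact: (polyfun_cst 1).
by apply: (@polyfun_ext (fun E => F E * F E ^+ n)) => [E|];
  [rewrite exprS | exact: polyfun_mul].
Qed.

Lemma polyfun_subst F (s : nat -> (nat -> R) -> R) :
  polyfun F -> (forall i, polyfun (s i)) -> polyfun (fun E => F (s ^~ E)).
Proof.
move=> + ps; elim=> [c|i|F1 G1 _ IF _ IG|F1 G1 _ IF _ IG].
- exact: polyfun_cst.
- exact: ps.
- exact: polyfun_add IF IG.
- exact: polyfun_mul IF IG.
Qed.

Lemma sa_ext P Q : (forall E, P E <-> Q E) -> sa P -> sa Q.
Proof. by move=> PQ; have -> : P = Q by apply/funext => E; apply/propext. Qed.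

Lemma sa_subst P (s : nat -> (nat -> R) -> R) :
  sa P -> (forall i, polyfun (s i)) -> sa (fun E => P (s ^~ E)).
Proof.
move=> + ps; elim=> [F pF|P1 _ IP|P1 Q1 _ IP _ IQ].
- by apply: (@sa_pos (fun E => F (s ^~ E))); apply: polyfun_subst.
- exact: (@sa_not (fun E => P1 (s ^~ E))).
- exact: (@sa_and (fun E => P1 (s ^~ E)) (fun E => Q1 (s ^~ E))).
Qed.

Lemma sa_lt F G : polyfun F -> polyfun G -> sa (fun E => F E < G E).
Proof.
move=> pF pG; apply: (@sa_ext (fun E => 0 < G E - F E)).
  by move=> E; rewrite subr_gt0.
exact/sa_pos/polyfun_sub.
Qed.

Lemma sa_le F G : polyfun F -> polyfun G -> sa (fun E => F E <= G E).
Proof.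
move=> pF pG; apply: (@sa_ext (fun E => ~ G E < F E)).
  by move=> E; rewrite leNgt; split=> /negP.
exact/sa_not/sa_lt.
Qed.

Lemma sa_or P Q : sa P -> sa Q -> sa (fun E => P E \/ Q E).
Proof.
move=> sP sQ; apply: (@sa_ext (fun E => ~ (~ P E /\ ~ Q E))).
  by move=> E; rewrite not_andE !notK.
exact: (sa_not (sa_and (sa_not sP) (sa_not sQ))).
Qed.

Lemma sa_imp P Q : sa P -> sa Q -> sa (fun E => P E -> Q E).
Proof.
move=> sP sQ; apply: (@sa_ext (fun E => ~ P E \/ Q E)).
  by move=> E; rewrite implyE.
exact: (sa_or (sa_not sP) sQ).
Qed.

Lemma sa_eq F G : polyfun F -> polyfun G -> sa (fun E => F E = G E).
Proof.
move=> pF pG; apply: (@sa_ext (fun E => F E <= G E /\ G E <= F E)).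
  by move=> E; split=> [[? ?]|->]; [apply/le_anti/andP | split].
exact: (sa_and (sa_le pF pG) (sa_le pG pF)).
Qed.

Lemma sa_true : sa (fun=> True).
Proof.
apply: (@sa_ext (fun=> 0 < 1)); last exact: (sa_pos (polyfun_cst 1)).
by move=> E; rewrite ltr01.
Qed.

Lemma sa_cst (A : Prop) : sa (fun=> A).
Proof.
have [a|na] := pselect A; first exact: (sa_ext _ sa_true).
by apply: (sa_ext _ (sa_not sa_true)) => _; tauto.
Qed.

Lemma sa_all_seq (T : eqType) (r : seq T) (Q : T -> (nat -> R) -> Prop) :
  (forall i, sa (Q i)) -> sa (fun E => forall i, i \in r -> Q i E).
Proof.
move=> sQ; elim: r => [|i r IH]; first exact: (sa_ext _ sa_true).
apply: (sa_ext _ (sa_and (sQ i) IH)) => E; split.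
  by move=> [Qi Qr] j; rewrite in_cons => /orP[/eqP ->|/Qr].
by move=> H; split=> [|j jr]; apply: H; rewrite in_cons ?eqxx// jr orbT.
Qed.

Lemma sa_all_fin (T : finType) (Q : T -> (nat -> R) -> Prop) :
  (forall i, sa (Q i)) -> sa (fun E => forall i, Q i E).
Proof.
move=> sQ; apply: (sa_ext _ (@sa_all_seq _ (enum T) _ sQ)) => E.
by split=> H i //; apply: H; rewrite mem_enum.
Qed.

(** * Existential quantification through quantifier elimination *)

Import ordered_qelim.

Lemma polyfun_term F : polyfun F ->
  exists t : GRing.term R, forall e, GRing.eval e t = F (nth 0 e).
Proof.
elim=> [c|i|F1 G1 _ [t tE] _ [u uE]|F1 G1 _ [t tE] _ [u uE]].
- by exists (GRing.Const c).
- by exists (GRing.Var R i).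
- by exists (GRing.Add t u) => e /=; rewrite tE uE.
- by exists (GRing.Mul t u) => e /=; rewrite tE uE.
Qed.

Lemma sa_formula P : sa P ->
  exists f : ord.formula R, forall e, ord.holds e f <-> P (nth 0 e).
Proof.
elim=> [F /polyfun_term[t tE]|P1 _ [f fE]|P1 Q1 _ [f fE] _ [g gE]].
- by exists (ord.Lt (GRing.NatConst R 0) t) => e /=; rewrite tE.
- by exists (ord.Not f) => e /=; rewrite fE.
- by exists (ord.And f g) => e /=; rewrite fE gE.
Qed.

Lemma term_polyfun (t : GRing.term R) : GRing.rterm t ->
  exists2 F, polyfun F & forall e, GRing.eval e t = F (nth 0 e).
Proof.
elim: t => //=.
- by move=> i _; exists (fun E => E i) => //; apply: polyfun_var.
- by move=> c _; exists (fun=> c) => //; apply: polyfun_cst.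
- by move=> k _; exists (fun=> k%:R) => //; apply: polyfun_cst.
- move=> t IHt u IHu /andP[/IHt[F pF tE] /IHu[G pG uE]].
  by exists (fun E => F E + G E) => [|e]; [exact: polyfun_add | rewrite tE uE].
- move=> t IHt /IHt[F pF tE].
  by exists (fun E => - F E) => [|e]; [exact: polyfun_opp | rewrite tE].
- move=> t IHt k /IHt[F pF tE]; exists (fun E => F E * k%:R) => [|e].
    by apply: polyfun_mul => //; apply: polyfun_cst.
  by rewrite tE mulr_natr.
- move=> t IHt u IHu /andP[/IHt[F pF tE] /IHu[G pG uE]].
  by exists (fun E => F E * G E) => [|e]; [exact: polyfun_mul | rewrite tE uE].
- move=> t IHt k /IHt[F pF tE].
  by exists (fun E => F E ^+ k) => [|e]; [exact: polyfun_exp | rewrite tE].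
Qed.

Lemma qf_formula_sa (f : ord.formula R) : ord.qf_form f -> ord.rformula f ->
  exists2 P, sa P & forall e, ord.holds e f <-> P (nth 0 e).
Proof.
elim: f => //=.
- by move=> b _ _; exists (fun=> b) => //; apply: sa_cst.
- move=> t u _ /andP[/term_polyfun[F pF tE] /term_polyfun[G pG uE]].
  by exists (fun E => F E = G E) => [|e]; [exact: sa_eq | rewrite tE uE].
- move=> t u _ /andP[/term_polyfun[F pF tE] /term_polyfun[G pG uE]].
  by exists (fun E => F E < G E) => [|e]; [exact: sa_lt | rewrite tE uE].
- move=> t u _ /andP[/term_polyfun[F pF tE] /term_polyfun[G pG uE]].
  by exists (fun E => F E <= G E) => [|e]; [exact: sa_le | rewrite tE uE].
- move=> f IHf g IHg /andP[qf qg] /andP[/(IHf qf)[P sP fE] /(IHg qg)[Q sQ gE]].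
  by exists (fun E => P E /\ Q E) => [|e]; [exact: sa_and | rewrite fE gE].
- move=> f IHf g IHg /andP[qf qg] /andP[/(IHf qf)[P sP fE] /(IHg qg)[Q sQ gE]].
  by exists (fun E => P E \/ Q E) => [|e]; [exact: sa_or | rewrite fE gE].
- move=> f IHf g IHg /andP[qf qg] /andP[/(IHf qf)[P sP fE] /(IHg qg)[Q sQ gE]].
  by exists (fun E => P E -> Q E) => [|e]; [exact: sa_imp | rewrite fE gE].
- move=> f IHf qf /(IHf qf)[P sP fE].
  by exists (fun E => ~ P E) => [|e]; [exact: sa_not | rewrite fE].
Qed.

(** Tarski's quantifier elimination is used here only; everything else about
    [sa] is an induction over quantifier-free predicates. *)
Lemma formula_sa (f : ord.formula R) :
  exists2 P, sa P & forall e, ord.holds e f <-> P (nth 0 e).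
Proof.
pose q := ord.quantifier_elim
    (fun i bc => qe_rcf.qfr_to_formula (qe_rcf.wproj i bc)) (ord.to_rform f).
have /andP[qq rq] : ord.qf_form q && ord.rformula q.
  apply: (ord.quantifier_elim_wf (@qe_rcf.wf_QE_wproj R)).
  exact: ord.to_rform_rformula.
have [P sP qE] := qf_formula_sa qq rq.
exists P => // e; rewrite -qE.
apply: (iff_trans (rwP (qe_rcf.rcf_satP e f))).
exact: (iff_sym (rwP (ord.qf_evalP e qq))).
Qed.

Lemma polyfun_local F : polyfun F ->
  exists N : nat, forall E1 E2, (forall i, (i < N)%N -> E1 i = E2 i) -> F E1 = F E2.
Proof.
elim=> [c|i|F1 G1 _ [M FE] _ [N GE]|F1 G1 _ [M FE] _ [N GE]].
- by exists 0%N.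
- by exists i.+1 => E1 E2; apply.
- exists (maxn M N) => E1 E2 H; congr (_ + _); [apply: FE|apply: GE] => i iN.
    by apply: H; rewrite leq_max iN.
  by apply: H; rewrite leq_max iN orbT.
- exists (maxn M N) => E1 E2 H; congr (_ * _); [apply: FE|apply: GE] => i iN.
    by apply: H; rewrite leq_max iN.
  by apply: H; rewrite leq_max iN orbT.
Qed.

(** Formulas are evaluated at finite lists padded with 0, predicates at infinite assignments. As a
    predicate reads finitely many variables, an assignment can be truncated to a list. *)
Lemma sa_local P : sa P ->
  exists N : nat, forall E1 E2, (forall i, (i < N)%N -> E1 i = E2 i) -> P E1 <-> P E2.
Proof.
elim=> [F /polyfun_local[N FE]|P1 _ [N PE]|P1 Q1 _ [M PE] _ [N QE]].
- by exists N => E1 E2 /FE ->.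
- by exists N => E1 E2 /PE H; rewrite H.
- exists (maxn M N) => E1 E2 H.
  have H1 : P1 E1 <-> P1 E2.
    by apply: PE => i iN; apply: H; rewrite leq_max iN.
  have H2 : Q1 E1 <-> Q1 E2.
    by apply: QE => i iN; apply: H; rewrite leq_max iN orbT.
  by rewrite H1 H2.
Qed.

Definition econs (x : R) E : nat -> R := fun i => if i is j.+1 then E j else x.

Lemma sa_ex_econs P : sa P -> sa (fun E => exists x, P (econs x E)).
Proof.
move=> sP; have [f fE] := sa_formula sP.
have [Q sQ QE] := formula_sa (ord.Exists 0 f).
(* The quantifier overwrites slot 0 of the list, so that slot gets a dummy 0 and the free variables
   follow it. *)
pose Q0 E := Q (econs 0 E).
have sQ0 : sa Q0.
  pose s i := fun E : nat -> R => econs 0 E i.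
  apply: (@sa_ext (fun E => Q (s ^~ E))) => [E //|].
  by apply: sa_subst => // -[|i]; [exact: polyfun_cst | exact: polyfun_var].
have [M ME] := sa_local sP; have [N NE] := sa_local sQ0.
apply: (sa_ext _ sQ0) => E.
pose e := mkseq E (maxn M N).
have eE i : (i < maxn M N)%N -> E i = e`_i by move=> iN; rewrite nth_mkseq.
have nthE x : nth 0 (x :: e) = econs x (nth 0 e) by apply/funext => -[].
have -> : Q0 E <-> Q0 (nth 0 e).
  by apply: NE => i iN; apply: eE; rewrite leq_max iN orbT.
rewrite /Q0 -nthE -QE /=.
have PE x : P (econs x E) <-> ord.holds (x :: e) f.
  rewrite fE nthE; apply: ME => -[//|i] iM /=; apply: eE.
  by rewrite leq_max (ltnW iM).
by split=> -[x Hx]; exists x; apply/PE.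
Qed.

Lemma sa_ex (Q : R -> (nat -> R) -> Prop) :
  sa (fun E => Q (E 0%N) (fun i => E i.+1)) -> sa (fun E => exists x, Q x E).
Proof. exact: sa_ex_econs. Qed.

Lemma sa_all (Q : R -> (nat -> R) -> Prop) :
  sa (fun E => Q (E 0%N) (fun i => E i.+1)) -> sa (fun E => forall x, Q x E).
Proof.
move=> sQ; apply: (@sa_ext (fun E => ~ exists x, ~ Q x E)).
  by move=> E; rewrite -forallNE; split=> H x; [apply: contrapT|move=> /(_ (H x))].
apply: sa_not; apply: (@sa_ex (fun x E => ~ Q x E)).
exact: (sa_not sQ).
Qed.

Definition polyvec n (V : (nat -> R) -> 'rV[R]_n) :=
  forall i, polyfun (fun E => V E 0 i).

Lemma polyvec_row n (V : 'I_n -> (nat -> R) -> R) :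
  (forall i, polyfun (V i)) -> polyvec (fun E => \row_i V i E).
Proof. by move=> pV i; apply: (polyfun_ext _ (pV i)) => E; rewrite mxE. Qed.

Lemma sa_ex_rV n (Q : 'rV[R]_n -> (nat -> R) -> Prop) :
  sa (fun E => Q (\row_i E i) (fun i => E (n + i)%N)) ->
  sa (fun E => exists v, Q v E).
Proof.
elim: n Q => [|n IH] Q sQ.
  apply: (sa_ext _ sQ) => E; split=> [QE|[v]]; first by eexists; apply: QE.
  by rewrite (_ : v = \row_i E i)//; apply/rowP => -[].
(* The first coordinate is quantified innermost: it takes variable 0 and pushes the others to 1,
   ..., n, the order of [\row_i E i]. *)
pose Q1 (v : 'rV[R]_n) E := exists x, Q (row_mx (\row_(i < 1) x) v) E.
apply: (@sa_ext (fun E => exists v, Q1 v E)) => [E|].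
  split=> [[v [x ?]]|[v]]; first by exists (row_mx (\row_(i < 1) x) v).
  have vE : row_mx (\row_(i < 1) v 0 0) (rsubmx (v : 'rV[R]_(1 + n))) =
      v :> 'rV[R]_(1 + n).
    rewrite -[RHS](@hsubmxK _ 1 1 n); congr row_mx.
    apply/rowP => i; rewrite !mxE.
    by congr (v _ _); apply/val_inj; rewrite /= ord1.
  move=> QE; exists (rsubmx (v : 'rV[R]_(1 + n))), (v 0 0).
  by move: QE; rewrite -{1}vE.
apply: IH; apply: (@sa_ex (fun x E => Q (row_mx (\row_(i < 1) x) (\row_i E i))
                                        (fun i => E (n + i)%N))).
apply: (sa_ext _ sQ) => E.
rewrite (_ : row_mx _ _ = \row_i E i) //.
apply/rowP => i; rewrite [RHS]mxE; case: (@splitP 1 n i) => j ij.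
  have -> : i = lshift n j by apply/val_inj.
  by rewrite row_mxEl mxE /= ord1.
have -> : i = rshift 1 j by apply/val_inj.
by rewrite row_mxEr mxE.
Qed.

Lemma sa_all_rV n (Q : 'rV[R]_n -> (nat -> R) -> Prop) :
  sa (fun E => Q (\row_i E i) (fun i => E (n + i)%N)) ->
  sa (fun E => forall v, Q v E).
Proof.
move=> sQ; apply: (@sa_ext (fun E => ~ exists v, ~ Q v E)).
  by move=> E; rewrite -forallNE; split=> H x; [apply: contrapT|move=> /(_ (H x))].
apply: sa_not; apply: (@sa_ex_rV _ (fun v E => ~ Q v E)).
exact: (sa_not sQ).
Qed.

Definition safam n (A : R -> 'rV[R]_n -> Prop) :=
  sa (fun E => A (E 0%N) (\row_i E i.+1)).

Lemma safam_subst n (A : R -> 'rV[R]_n -> Prop) F (V : (nat -> R) -> 'rV[R]_n) :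
  safam A -> polyfun F -> polyvec V -> sa (fun E => A (F E) (V E)).
Proof.
move=> sA pF pV.
pose o j : option 'I_n := insub j.
(* A substitution is total, so the variables that [A] does not read are sent to 0. *)
pose s i E := if i is j.+1 then oapp (fun k => V E 0 k) 0 (o j) else F E.
apply: (@sa_ext (fun E => A (s 0%N E) (\row_i s i.+1 E))) => [E|].
  rewrite (_ : \row_i _ = V E)//; apply/rowP => i.
  by rewrite mxE /s /o /= valK.
apply: (sa_subst (s := s) sA) => -[|j] //=.
by rewrite /s; case: (o j) => [k|]; [exact: (pV k)|exact: polyfun_cst].
Qed.

End SemialgebraicPredicates.

(** * Germs at [0+] and the monotonicity theorem *)

Section Germs.
Context {R : realType}.
Implicit Types (E : nat -> R) (F : (nat -> R) -> R) (p : {poly R}) (u : R -> R).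

Definition germ (P : R -> Prop) := exists2 d, 0 < d & forall r, 0 < r -> r < d -> P r.

Lemma germ_and (P Q : R -> Prop) :
  germ P -> germ Q -> germ (fun r => P r /\ Q r).
Proof.
move=> [d d0 Pd] [e e0 Qe]; exists (Num.min d e); first by rewrite lt_min d0.
by move=> r r0; rewrite lt_min => /andP[rd re]; split; [exact: Pd|exact: Qe].
Qed.

Lemma germ_imp (P Q : R -> Prop) : (forall r, 0 < r -> P r -> Q r) -> germ P -> germ Q.
Proof. by move=> PQ [d d0 Pd]; exists d => // r r0 rd; apply: PQ => //; apply: Pd. Qed.

Lemma germ_exists (P : R -> Prop) : germ P -> exists2 r, 0 < r & P r.
Proof. by move=> [d d0 Pd]; exists (d / 2); [lra|apply: Pd; lra]. Qed.

Lemma pos_lt2 (x y : R) : 0 < x -> 0 < y -> exists2 e, 0 < e & e < x /\ e < y.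
Proof.
by move=> x0 y0; have [xy|yx] := leP x y; [exists (x / 2)|exists (y / 2)]; lra.
Qed.

Lemma polyfun_line F E : polyfun F -> exists p, forall r, F (econs r E) = p.[r].
Proof.
elim=> [c|[|i]|F1 G1 _ [p pE] _ [q qE]|F1 G1 _ [p pE] _ [q qE]].
- by exists c%:P => r; rewrite hornerC.
- by exists 'X => r; rewrite hornerX.
- by exists (E i)%:P => r; rewrite hornerC.
- by exists (p + q) => r; rewrite hornerD pE qE.
- by exists (p * q) => r; rewrite hornerM pE qE.
Qed.

(** A nonzero polynomial has constant sign between 0 and its next root. *)
Lemma poly_germ p : germ (fun r => 0 < p.[r]) \/ germ (fun r => ~ 0 < p.[r]).
Proof.
have [->|p0] := eqVneq p 0.
  by right; exists 1 => // r _ _; rewrite horner0 ltxx.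
have d0 := polyrcf.next_root_gt (@ltr01 R) p0.
have sgp r : 0 < r -> r < polyrcf.next_root p 0 1 ->
    Num.sg p.[r] = polyrcf.sgp_right p 0.
  move=> r0 rd; apply: (polyrcf.sgr_neighpr (b := 1)).
  by rewrite /polyrcf.neighpr in_itv /= r0.
have [pp|pp] := ltP 0 (polyrcf.sgp_right p 0); [left|right].
  by exists (polyrcf.next_root p 0 1) => // r r0 /(sgp r r0) pr; rewrite -sgr_gt0 pr.
exists (polyrcf.next_root p 0 1) => // r r0 /(sgp r r0) pr.
by rewrite -sgr_gt0 pr; apply/negP; rewrite -leNgt.
Qed.

(** One-variable o-minimality at [0+]: the atomic case is the constant sign of a polynomial, and the
    dichotomy passes to Boolean combinations. *)
Lemma sa_germ P E : sa P ->
  germ (fun r => P (econs r E)) \/ germ (fun r => ~ P (econs r E)).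
Proof.
elim=> [F pF|P1 _ [|]|P1 Q1 _ IP _ IQ].
- have [p pE] := polyfun_line E pF.
  by case: (poly_germ p) => H; [left|right];
    move: H; apply: germ_imp => r _; rewrite pE.
- by move=> H; right; move: H; apply: germ_imp => r _ Pr; apply.
- by left.
- case: IP => [P1E|P1E]; last first.
    by right; move: P1E; apply: germ_imp => r _ ? [].
  case: IQ => [Q1E|Q1E]; first by left; apply: germ_and.
  by right; move: Q1E; apply: germ_imp => r _ ? [].
Qed.

Lemma sa_germ1 (Q : R -> Prop) : sa (fun E => Q (E 0%N)) ->
  germ Q \/ germ (fun r => ~ Q r).
Proof. exact: (@sa_germ _ (fun=> 0)). Qed.

Lemma sa_germ_pred (Q : R -> R -> Prop) : sa (fun E => Q (E 0%N) (E 1%N)) ->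
  sa (fun E => germ (Q (E 0%N))).
Proof.
move=> sQ; apply: (@sa_ext _ (fun E => exists d, 0 < d /\
    forall r, 0 < r -> r < d -> Q (E 0%N) r)) => [E|].
  by split=> [[d [d0 H]]|[d d0 H]]; exists d.
apply: (@sa_ex _ (fun d E => 0 < d /\ forall r, 0 < r -> r < d -> Q (E 0%N) r)).
apply: sa_and; first exact: sa_lt (polyfun_cst 0) (polyfun_var 0).
apply: (@sa_all _ (fun r E => 0 < r -> r < E 0%N -> Q (E 1%N) r)).
apply: sa_imp; first exact: sa_lt (polyfun_cst 0) (polyfun_var 0).
apply: sa_imp; first exact: sa_lt (polyfun_var 0) (polyfun_var 1).
pose s i : (nat -> R) -> R := if i is 0%N then fun E => E 2%N else fun E => E 0%N.
apply: (sa_subst (s := s) sQ) => -[|i]; exact: polyfun_var.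
Qed.

(** The dichotomy is applied to [germ (Q r)], a definable predicate of [r], and then, for each [r]
    where it fails, to the section [Q r]. *)
Lemma sa_germ2 (Q : R -> R -> Prop) : sa (fun E => Q (E 0%N) (E 1%N)) ->
  germ (fun r => germ (Q r)) \/ germ (fun r => germ (fun t => ~ Q r t)).
Proof.
move=> sQ; have [H|H] := @sa_germ1 (fun r => germ (Q r)) (sa_germ_pred sQ).
  by left.
right; move: H; apply: germ_imp => r _ nQ.
have [//|//] : germ (Q r) \/ germ (fun t => ~ Q r t).
apply: (@sa_germ1 (Q r)).
pose s i : (nat -> R) -> R := if i is 0%N then fun E => r else fun E => E 0%N.
apply: (sa_subst (s := s) sQ) => -[|i]; [exact: polyfun_cst|exact: polyfun_var].
Qed.

(** A real function has only countably many strict local minimisers: the pair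
    [(k, floor (r (k + 1)))], with [1 / (k + 1)] a radius of strict minimality at [r],
    determines [r]. *)
Lemma strict_local_min_impossible u (a b : R) : a < b ->
  ~ (forall r, a < r -> r < b ->
       germ (fun t => u r < u (r + t) /\ u r < u (r - t))).
Proof.
move=> ab H.
have /choice[k kP] : forall r, exists k : nat, a < r -> r < b ->
    forall s, s != r -> `|s - r| < k.+1%:R^-1 -> u r < u s.
  move=> r; have [ar|] := boolP (a < r); last by exists 0%N.
  have [rb|] := boolP (r < b); last by exists 0%N.
  have [d d0 dP] := H r ar rb.
  exists (Num.truncn d^-1) => _ _ s sr srk.
  have srd : `|s - r| < d.
    apply: (lt_trans srk); rewrite -[ltRHS]invrK ltf_pV2 ?posrE ?invr_gt0//.
    exact: truncnS_gt.
  case: (ltgtP s r) sr srd => [sr _|sr _|_ //].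
    rewrite ltr0_norm ?subr_lt0// => /dP[]; first by lra.
    by move=> _; rewrite opprK addrC subrK.
  rewrite gtr0_norm ?subr_gt0// => /dP[]; first by lra.
  by rewrite addrC subrK.
have : countable (`]a, b[%classic : set R).
  apply/countable_injP.
  exists (fun r => pickle (k r, Num.floor (r * (k r).+1%:R))).
  move=> r s; rewrite !inE /= !in_itv /= => /andP[ar rb] /andP[a_s sb].
  move/(pcan_inj pickleK) => [krs]; rewrite -krs => frs.
  apply/eqP; apply: contraT => rs.
  have k0 : 0 < (k r).+1%:R :> R by rewrite ltr0n.
  have rsk : `|r - s| < (k r).+1%:R^-1.
    rewrite -[ltRHS]mul1r ltr_pdivlMr// -[X in _ * X]gtr0_norm// -normrM mulrBl.
    have := floor_itv (r * (k r).+1%:R); have := floor_itv (s * (k r).+1%:R).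
    rewrite frs intrD => /andP[s1 s2] /andP[r1 r2].
    by rewrite ltr_norml; apply/andP; split; lra.
  have := kP s a_s sb r rs; rewrite -krs => /(_ rsk) sr.
  have := kP r ar rb s; rewrite eq_sym => /(_ rs); rewrite distrC => /(_ rsk) rs'.
  by have := lt_trans sr rs'; rewrite ltxx.
(* A countable interval would have measure 0 instead of [b - a]. *)
move=> /countable_lebesgue_measure0; rewrite lebesgue_measure_itv /= lte_fin ab.
by rewrite -EFinB => -[]; lra.
Qed.

(** Real induction: the left half of the local hypothesis puts the supremum [c] of [S] into [S], and
    the right half moves beyond [c] unless [c = s]. *)
Lemma locally_homo_homo u (a b : R) :
  (forall r, a < r -> r < b -> germ (fun t => u r <= u (r + t) /\ u (r - t) <= u r)) ->
  forall r s, a < r -> r <= s -> s < b -> u r <= u s.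
Proof.
move=> H r s ar rs sb.
pose S := [set t | r <= t <= s /\ forall w, r <= w <= t -> u r <= u w].
have Sr : S r.
  split=> [|w]; first by rewrite lexx rs.
  by move=> rw; rewrite (le_anti (y := w) (x := r)).
have supS : has_sup S by split; [exists r|exists s => t [/andP[]]].
set c := sup S.
have rc : r <= c by apply: (sup_upper_bound supS).
have cs : c <= s by apply: ge_sup => [|t [/andP[]]]//; exists r.
have below w : r <= w -> w < c -> u r <= u w.
  move=> rw wc; have [||t [_ tP] ct] := @sup_adherent _ S (c - w); first lra.
    by [].
  by apply: tP; rewrite rw /=; move: ct; rewrite -/c; lra.
have [||d d0 dP] := H c; [lra|lra|].
have Sc : S c.
  split=> [|w /andP[rw wc]]; first by rewrite rc cs.
  have [/below->//|cw] := ltP w c; have {w rw wc cw}-> : w = c by apply/le_anti/andP.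
  have [->//|rc'] := eqVneq r c.
  have {}rc : r < c by rewrite lt_neqAle rc' rc.
  have [|e e0 [ed ecr]] := @pos_lt2 d (c - r) d0; first by rewrite subr_gt0.
  have [_ H1] := dP _ e0 ed; apply: le_trans H1; apply: below; lra.
have [<-|cs'] := eqVneq c s; first by case: Sc => _; apply; rewrite rc lexx.
have {}cs : c < s by rewrite lt_neqAle cs' cs.
have [|e e0 [ed es]] := @pos_lt2 d (s - c) d0; first by rewrite subr_gt0.
suff : S (c + e) by move=> /(sup_upper_bound supS); rewrite -/c; lra.
split=> [|w /andP[rw wce]]; first by apply/andP; split; lra.
have [wc|cw] := leP w c; first by case: Sc => _; apply; rewrite rw.
have urc : u r <= u c by case: Sc => _; apply; rewrite rc lexx.
have [||+ _] := dP (w - c); [lra|lra|].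
by rewrite addrC subrK; apply: le_trans.
Qed.
End Germs.

Section Monotonicity.
Context {R : realType}.
Implicit Types (E : nat -> R) (F G : (nat -> R) -> R) (u : R -> R).

Definition safun u := sa (fun E => u (E 0%N) = E 1%N).

Lemma safun_subst u F G : safun u -> polyfun F -> polyfun G ->
  sa (fun E => u (F E) = G E).
Proof.
move=> su pF pG; pose s i := if i is 0%N then F else G.
by apply: (sa_subst (s := s) su) => -[|i].
Qed.

Lemma safun_lt u F G : safun u -> polyfun F -> polyfun G ->
  sa (fun E => u (F E) < u (G E)).
Proof.
move=> su pF pG.
apply: (@sa_ext _ (fun E => exists a b, [/\ u (F E) = a, u (G E) = b & a < b])) => [E|].
  by split=> [[a [b [-> ->]]]//|uFG]; exists (u (F E)), (u (G E)).
have pS H : polyfun H -> polyfun (fun E : nat -> R => H (fun i => E i.+2)).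
  by move=> pH; apply: (polyfun_subst pH) => i; apply: polyfun_var.
apply: (@sa_ex _ (fun a E => exists b, [/\ u (F E) = a, u (G E) = b & a < b])).
apply: (@sa_ex _ (fun b E => [/\ u (F (fun i => E i.+1)) = E 0%N,
  u (G (fun i => E i.+1)) = b & E 0%N < b])).
apply: (@sa_ext _ (fun E => u (F (fun i => E i.+2)) = E 1%N /\
   (u (G (fun i => E i.+2)) = E 0%N /\ E 1%N < E 0%N))) => [E|].
  by split=> [[? []]|[]].
apply: sa_and; first by apply: safun_subst (polyfun_var 1) => //; apply: pS.
apply: sa_and; first by apply: safun_subst (polyfun_var 0) => //; apply: pS.
exact: sa_lt (polyfun_var 1) (polyfun_var 0).
Qed.

(** Each of the four strict comparisons of [u r] with [u (r + t)] and [u (r - t)] is settled as [t]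
    tends to 0, in the same way for all small [r]. Either the outcomes give local monotonicity, or
    they are contradictory, or every small [r] is a strict local extremum, which countability
    excludes. *)
Lemma safun_monotone u : safun u -> exists2 d, 0 < d &
  (forall r s, 0 < r -> r <= s -> s < d -> u r <= u s) \/
  (forall r s, 0 < r -> r <= s -> s < d -> u s <= u r).
Proof.
move=> su.
have pp : polyfun (fun E => E 0%N + E 1%N).
  exact: polyfun_add (polyfun_var 0) (polyfun_var 1).
have pm : polyfun (fun E => E 0%N - E 1%N).
  exact: polyfun_sub (polyfun_var 0) (polyfun_var 1).
have A := sa_germ2 (Q := fun r t => u r < u (r + t)) (safun_lt su (polyfun_var 0) pp).
have B := sa_germ2 (Q := fun r t => u (r + t) < u r) (safun_lt su pp (polyfun_var 0)).
have C := sa_germ2 (Q := fun r t => u (r - t) < u r) (safun_lt su pm (polyfun_var 0)).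
have D := sa_germ2 (Q := fun r t => u r < u (r - t)) (safun_lt su (polyfun_var 0) pm).
have up : germ (fun r => germ (fun t => ~ u (r + t) < u r)) ->
  germ (fun r => germ (fun t => ~ u r < u (r - t))) -> exists2 d, 0 < d &
  forall r s, 0 < r -> r <= s -> s < d -> u r <= u s.
  move=> H1 H2; have [d d0 H] := germ_and H1 H2.
  exists d => //; apply: locally_homo_homo => r r0 rd.
  have [G1 G2] := H r r0 rd; have G := germ_and G1 G2.
  by move: G; apply: germ_imp => t _; rewrite !ltNge => -[/negP/negPn ? /negP/negPn].
have dn : germ (fun r => germ (fun t => ~ u r < u (r + t))) ->
  germ (fun r => germ (fun t => ~ u (r - t) < u r)) -> exists2 d, 0 < d &
  forall r s, 0 < r -> r <= s -> s < d -> u s <= u r.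
  move=> H1 H2; have [d d0 H] := germ_and H1 H2.
  exists d => // r s r0 rs sd; rewrite -lerN2.
  apply: (@locally_homo_homo _ (fun x => - u x) 0 d) => // {r0 rs}r r0 rd.
  have [G1 G2] := H r r0 rd; have G := germ_and G1 G2.
  move: G; apply: germ_imp => t _.
  by rewrite !lerN2 !ltNge => -[/negP/negPn ? /negP/negPn].
have absurd2 (P Q : R -> R -> Prop) : (forall r t, P r t -> Q r t -> False) ->
    germ (fun r => germ (P r)) -> germ (fun r => germ (Q r)) -> False.
  move=> PQ GP GQ; have [r _ [Pr Qr]] := germ_exists (germ_and GP GQ).
  by have [t _ [/PQ]] := germ_exists (germ_and Pr Qr); apply.
case: A => [A|A]; case: B => [B|B].
- by exfalso; apply: absurd2 A B => r t /lt_trans H /H; rewrite ltxx.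
- case: D => [D|D]; last by have [d d0 ?] := up B D; exists d => //; left.
  exfalso; have [d d0 H] := germ_and A D.
  apply: (@strict_local_min_impossible _ u 0 d) => // r r0 rd.
  by have [G1 G2] := H r r0 rd; apply: germ_and.
- case: C => [C|C]; last by have [d d0 ?] := dn A C; exists d => //; right.
  exfalso; have [d d0 H] := germ_and B C.
  apply: (@strict_local_min_impossible _ (fun x => - u x) 0 d) => // r r0 rd.
  have [G1 G2] := H r r0 rd; have G := germ_and G1 G2.
  by move: G; apply: germ_imp => t _; rewrite !ltrN2.
- case: C => [C|C]; last by have [d d0 ?] := dn A C; exists d => //; right.
  case: D => [D|D]; last by have [d d0 ?] := up B D; exists d => //; left.
  by exfalso; apply: absurd2 C D => r t /lt_trans H /H; rewrite ltxx.
Qed.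

End Monotonicity.

Section SupNorm.
Context {R : realType} {n : nat}.
Implicit Types z : 'rV[R]_n.

Lemma rV_norm_le z (M : R) : 0 <= M -> (forall i, `|z 0 i| <= M) -> `|z| <= M.
Proof.
move=> M0 zM; rewrite /Num.norm/= mx_normrE; apply: bigmax_le => // -[i j] _ /=.
by rewrite ord1.
Qed.

Lemma coord_le_norm z i : `|z 0 i| <= `|z|.
Proof.
rewrite [leRHS]/Num.norm/= mx_normrE.
exact: (le_bigmax _ (fun ij : 'I_1 * 'I_n => `|z ij.1 ij.2|) (0, i)).
Qed.

End SupNorm.

(** * Definable selection *)

Section Selection.
Context {R : realType} {n : nat}.
Implicit Types (A : R -> 'rV[R]_n -> Prop) (i : 'I_n).

Definition minimize i A r z := A r z /\ forall w, A r w -> z 0 i <= w 0 i.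

Lemma safam_minimize i A : safam A -> safam (minimize i A).
Proof.
move=> sA; rewrite /safam /minimize; apply: sa_and => //.
apply: (@sa_all_rV _ _ (fun w E => A (E 0%N) w -> (\row_j E j.+1) 0 i <= w 0 i)).
apply: sa_imp.
  apply: (safam_subst sA); first exact: polyfun_var.
  by apply: polyvec_row => j; apply: polyfun_var.
apply: sa_le; first by apply: polyfun_ext (polyfun_var (n + i.+1)) => E; rewrite mxE.
by apply: polyfun_ext (polyfun_var i) => E; rewrite mxE.
Qed.

Definition compact_nonempty (K : set 'rV[R]_n) := compact K /\ K !=set0.

Lemma compact_nonempty_minimize i A r :
  compact_nonempty (A r) -> compact_nonempty (minimize i A r).
Proof.
move=> [cA A0].
have cf : continuous (fun z : 'rV[R]_n => z 0 i) by move=> z; exact: coord_continuous.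
have [c /[!inE] Ac cP] := EVT_min_rV A0 cA (continuous_subspaceT cf).
have cP' z : A r z -> c 0 i <= z 0 i by move=> Az; apply: cP; rewrite inE.
have mE : minimize i A r = A r `&` [set z | z 0 i <= c 0 i].
  apply/seteqP; split=> z [Az zP]; split => //; first exact: zP.
  by move=> w /cP'; apply: le_trans.
split; last by exists c; split.
rewrite mE; apply: compact_closedI => //.
apply: (@preimage_closed _ _ (fun z : 'rV[R]_n => z 0 i) [set x | x <= c 0 i]).
  by move=> z _; exact: cf.
exact: closed_le.
Qed.

Definition lexmin (s : seq 'I_n) A := foldl (fun B i => minimize i B) A s.

(** Once a coordinate has been minimised, all remaining points share its value, and later
    minimisations only shrink the fibre. Minimising every coordinate thus leaves at most one
    point. *)
Lemma lexminP s A r :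
  (safam A -> safam (lexmin s A)) /\
  (compact_nonempty (A r) -> compact_nonempty (lexmin s A r)) /\
  forall z, lexmin s A r z -> A r z /\
    forall w, lexmin s A r w -> forall i, i \in s -> z 0 i = w 0 i.
Proof.
elim: s A => [|i s IH] A /=; first by split=> //; split=> // z Az; split.
have [H1 [H2 H3]] := IH (minimize i A); split; [|split].
- by move=> sA; apply/H1/safam_minimize.
- by move=> cA; apply/H2/compact_nonempty_minimize.
- move=> z lz; have [[Az zP] zs] := H3 z lz; split=> // w lw j.
  have [[Aw wP] _] := H3 w lw.
  rewrite in_cons => /orP[/eqP->|]; last exact: zs.
  by apply/le_anti; rewrite zP//= wP.
Qed.

(** Minimising the coordinates one after the other singles out a definable point
    of each compact fibre; [phi] is the sum of its eventually monotone coordinates,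
    with signs making each of them nondecreasing. *)
Lemma semialgebraic_selection A (M : R) (i0 : 'I_n) : safam A ->
  (forall r, closed (A r)) ->
  (forall r z, A r z -> forall i, `|z 0 i| <= M) ->
  exists2 d, 0 < d &
    (forall r z, 0 < r -> r < d -> ~ A r z) \/
    exists (u : R -> 'rV[R]_n) (phi : R -> R) (m : R),
      [/\ forall r, 0 < r -> r < d ->
            A r (u r) /\ forall z, A r z -> u r 0 i0 <= z 0 i0,
          forall r, 0 < r -> r < d -> m <= phi r &
          forall s r i, 0 < s -> s <= r -> r < d ->
            `|u r 0 i - u s 0 i| <= phi r - phi s].
Proof.
move=> sA clA bA.
have sne : sa (fun E => exists z, A (E 0%N) z).
  apply: (@sa_ex_rV _ _ (fun z E => A (E 0%N) z)).
  apply: (safam_subst sA); first exact: polyfun_var.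
  by apply: polyvec_row => j; apply: polyfun_var.
have [ne|[d d0 em]] := @sa_germ1 _ (fun r => exists z, A r z) sne; last first.
  by exists d => //; left=> r z r0 rd Az; apply: (em r r0 rd); exists z.
have cA r : compact (A r).
  apply: bounded_closed_compact => //.
  exists `|M|; split; first exact: num_real.
  move=> B MB z Az; apply: rV_norm_le => [|i].
    exact: le_trans (ltW MB).
  by rewrite (le_trans (bA r z Az i))// (le_trans (ler_norm _))// ltW.
(* Putting [i0] first makes the selected point minimise that coordinate over the whole fibre. *)
pose B := lexmin (i0 :: enum 'I_n) A.
have sB : safam B by have [+ _] := lexminP (i0 :: enum 'I_n) A 0; apply.
have neB r : (exists z, A r z) -> exists z, B r z.
  have [_ [cB _] [z Az]] := lexminP (i0 :: enum 'I_n) A r.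
  have [|_ [w Bw]] := cB; first by split=> //; exists z.
  by exists w.
have BA r z : B r z -> A r z.
  have [_ [_ H]] := lexminP (i0 :: enum 'I_n) A r.
  by move=> /H[].
have Bi0 r z : B r z -> forall w, A r w -> z 0 i0 <= w 0 i0.
  have [_ [_ H]] := lexminP (enum 'I_n) (minimize i0 A) r.
  by move=> /H[[]].
have Buniq r z w : B r z -> B r w -> z = w.
  have [_ [_ H]] := lexminP (i0 :: enum 'I_n) A r.
  move=> /H[_ zP] Bw; apply/rowP => i; apply: zP => //.
  by rewrite in_cons mem_enum orbT.
(* The value 0 on empty fibres is prescribed so that the graph of [u] is definable for all [r], not
   only near [0+]. *)
have /choice[u uP] : forall r, exists z, ((exists w, B r w) -> B r z) /\
    ((forall w, ~ B r w) -> z = 0).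
  move=> r; have [[w Bw]|nB] := pselect (exists w, B r w).
    by exists w; split=> // /(_ w).
  by exists 0; split=> // -[w Bw]; case: nB; exists w.
have su i : safun (fun r => u r 0 i).
  apply: (@sa_ext _ (fun E => (exists z, B (E 0%N) z /\ z 0 i = E 1%N) \/
     (~ (exists z, B (E 0%N) z) /\ 0 = E 1%N))) => [E|].
    have [uB u0] := uP (E 0%N); split.
      move=> [[z [Bz <-]]|[nB <-]].
        by rewrite (Buniq _ _ _ Bz (uB _))//; exists z.
      by rewrite u0 ?mxE// => w Bw; apply: nB; exists w.
    move=> <-; have [[w Bw]|nB] := pselect (exists w, B (E 0%N) w).
      by left; exists (u (E 0%N)); split=> //; apply: uB; exists w.
    by right; split=> //; rewrite u0 ?mxE// => w Bw; apply: nB; exists w.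
  have sBE k : sa (fun E => B (E (n + k)%N) (\row_j E j)).
    apply: (safam_subst sB); first exact: polyfun_var.
    by apply: polyvec_row => j; apply: polyfun_var.
  apply: sa_or; last apply: sa_and.
  - apply: (@sa_ex_rV _ _ (fun z E => B (E 0%N) z /\ z 0 i = E 1%N)).
    apply: sa_and; first exact: sBE.
    apply: sa_eq; last exact: polyfun_var.
    by apply: polyfun_ext (polyfun_var i) => E; rewrite mxE.
  - by apply: sa_not; apply: (@sa_ex_rV _ _ (fun z E => B (E 0%N) z)); exact: sBE.
  - exact: sa_eq (polyfun_cst 0) (polyfun_var 1).
have [d d0 dP] : exists2 d, 0 < d & forall r, 0 < r -> r < d -> exists z, B r z.
  by have [d d0 H] := ne; exists d => // r r0 rd; apply/neB/H.
have uB r : 0 < r -> r < d -> B r (u r).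
  by move=> r0 rd; apply: (uP r).1; apply: dP.
have /choice[e eP] : forall i, exists e : R * bool, 0 < e.1 /\
    forall r s, 0 < r -> r <= s -> s < e.1 ->
      (-1) ^+ e.2 * u r 0 i <= (-1) ^+ e.2 * u s 0 i.
  move=> i; have [e e0 [H|H]] := safun_monotone (su i).
    by exists (e, false); split=> // r s r0 rs se; rewrite !mul1r; apply: H.
  by exists (e, true); split=> // r s r0 rs se; rewrite !mulN1r lerN2; apply: H.
have [d' d'0 d'P] : exists2 d', 0 < d' & d' <= d /\ forall i, d' <= (e i).1.
  exists (\big[Order.min/d]_i (e i).1).
    by elim/big_rec: _ => // i x _ x0; rewrite lt_min (eP i).1.
  split; first by elim/big_rec: _ => // i x _ xd; rewrite ge_min xd orbT.
  by move=> i; apply: bigmin_le.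
exists d' => //; right.
exists u, (fun r => \sum_i (-1) ^+ (e i).2 * u r 0 i), (\sum_(i < n) - M).
have d'd r : r < d' -> r < d by move=> /lt_le_trans; apply; case: d'P.
split.
- by move=> r r0 /d'd rd; split; [apply/BA/uB|apply/Bi0/uB].
- move=> r r0 /d'd rd; apply: ler_sum => i _.
  have := bA _ _ (BA _ _ (uB r r0 rd)) i.
  rewrite -[X in X <= M](normrMsign (e i).2).
  by rewrite ler_norml => /andP[].
(* The increment of one coordinate is, up to sign, one of the nonnegative terms whose sum is the
   increment of [phi]. *)
- move=> s r i s0 sr rd'; rewrite -sumrB.
  have sgn j : 0 <= (-1) ^+ (e j).2 * u r 0 j - (-1) ^+ (e j).2 * u s 0 j.
    rewrite subr_ge0; apply: (eP j).2 => //.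
    by apply: (lt_le_trans rd'); case: d'P.
  rewrite (bigD1 i)//= -[leLHS](normrMsign (e i).2) mulrBr ger0_norm//.
  by rewrite lerDl sumr_ge0.
Qed.
End Selection.

(** * A Kurdyka-Lojasiewicz inequality for slopes *)

Section Desingularization.
Context {R : realType} {m : nat}.
Variables (G : R -> 'rV[R]_m -> Prop) (k c M : R).
Hypothesis k_ge0 : 0 <= k.
Hypothesis sG : safam G.
Hypothesis clG : forall a, closed [set z | exists2 s, G s z & s <= a].

(** [G] is the graph of a function [F]; [slope_le r z rho] says that [F z = c + r]
    (the case [w = z] of the second clause gives [c + r <= F z]) and that [F] decreases
    from [z] at rate at most [rho], up to the curvature term.  This replaces the
    distance from [0] to the subdifferential. *)
Definition slope_le r z (rho : R) :=
  (exists2 s, G s z & s <= c + r) /\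
  forall w s, G s w -> c + r <= s + rho * `|z - w| + k * `|z - w| ^+ 2.

(** The slope is stored as the first coordinate, to be the one minimised first; the bounds by [M]
    keep the fibres compact. *)
Let A r (v : 'rV[R]_(1 + m)) :=
  [/\ 0 <= v 0 (lshift m 0), v 0 (lshift m 0) <= M,
      forall i, `|v 0 (rshift 1 i)| <= M &
      slope_le r (rsubmx v) (v 0 (lshift m 0))].

(** The sup norm is not polynomial. The inequality is instead required for every [t] bounding the
    coordinates of [z - w] in absolute value; this is equivalent because its right-hand side is
    nondecreasing in [t >= 0]. *)
Let sa_A : safam A.
Proof.
pose v E : 'rV[R]_(1 + m) := \row_i E i.+1.
pose rho (E : nat -> R) := E 1%N.
pose z (E : nat -> R) : 'rV[R]_m := \row_i E i.+2.
have zE E : rsubmx (v E) = z E by apply/rowP => i; rewrite !mxE.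
have rhoE E : v E 0 (lshift m 0) = rho E by rewrite !mxE.
pose P (E : nat -> R) := 0 <= E 1%N /\ (E 1%N <= M /\
  ((forall i : 'I_m, - M <= E i.+2 /\ E i.+2 <= M) /\
  ((exists s, G s (z E) /\ s <= c + E 0%N) /\
   forall (w : 'rV[R]_m) s t, 0 <= t ->
     (forall i, z E 0 i - w 0 i <= t /\ w 0 i - z E 0 i <= t) ->
     G s w -> c + E 0%N <= s + E 1%N * t + k * (t * t)))).
have PE E : P E <-> A (E 0%N) (v E).
  rewrite /P /A rhoE zE /rho; split.
    move=> [r0 [rM [zM [[s [Gs sr]] H]]]]; split=> // [i|].
      by rewrite mxE ler_norml; case: (zM i) => /= -> ->.
    split; first by exists s.
    move=> w s' Gw; rewrite expr2; apply: (H w s' `|z E - w|) => // i.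
    have := coord_le_norm (z E - w) i; rewrite !mxE.
    rewrite ler_norml => /andP[? ?]; split; lra.
  move=> [r0 rM zM [[s Gs sr] H]]; split=> //; split=> //; split; [|split].
  - by move=> i; apply/andP; rewrite -ler_norml; have := zM i; rewrite mxE.
  - by exists s.
  - move=> w s' t t0 wt Gw; apply: (le_trans (H w s' Gw)).
    have zwt : `|z E - w| <= t.
      apply: rV_norm_le => // i; rewrite !mxE ler_norml.
      by have [] := wt i; rewrite !mxE => ? ?; apply/andP; split; lra.
    rewrite -expr2 lerD// ?lerD2l; first by rewrite ler_wpM2l.
    by rewrite ler_wpM2l// ler_sqr ?nnegrE.
apply: (sa_ext PE); rewrite /P.
have pz j i : polyfun (fun E => z (fun l => E (j + l)%N) 0 i).
  by apply: polyfun_ext (polyfun_var (j + i.+2)) => E; rewrite mxE.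
apply: sa_and; first exact: sa_le (polyfun_cst 0) (polyfun_var 1).
apply: sa_and; first exact: sa_le (polyfun_var 1) (polyfun_cst M).
apply: sa_and.
  apply: sa_all_fin => i; apply: sa_and.
    exact: sa_le (polyfun_cst _) (polyfun_var _).
  exact: sa_le (polyfun_var _) (polyfun_cst _).
apply: sa_and.
  apply: (@sa_ex _ (fun s E => G s (z E) /\ s <= c + E 0%N)).
  apply: sa_and.
    by apply: (safam_subst sG); [exact: polyfun_var|move=> i; exact: (pz 1%N)].
  apply: sa_le; first exact: polyfun_var.
  exact: polyfun_add (polyfun_cst _) (polyfun_var 1).
apply: (@sa_all_rV _ _ (fun w E => forall s t, 0 <= t ->
     (forall i, z E 0 i - w 0 i <= t /\ w 0 i - z E 0 i <= t) ->
     G s w -> c + E 0%N <= s + E 1%N * t + k * (t * t))).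
apply: (@sa_all _ (fun s E => forall t, 0 <= t ->
     (forall i, z (fun l => E (m + l)%N) 0 i - (\row_j E j) 0 i <= t
             /\ (\row_j E j) 0 i - z (fun l => E (m + l)%N) 0 i <= t) ->
     G s (\row_j E j) -> c + E (m + 0)%N <= s + E (m + 1)%N * t + k * (t * t))).
apply: (@sa_all _ (fun t E => 0 <= t ->
     (forall i, z (fun l => E (m + l).+1) 0 i - (\row_j E j.+1) 0 i <= t
             /\ (\row_j E j.+1) 0 i - z (fun l => E (m + l).+1) 0 i <= t) ->
     G (E 0%N) (\row_j E j.+1) ->
     c + E (m + 0).+1 <= E 0%N + E (m + 1).+1 * t + k * (t * t))).
apply: sa_imp; first exact: sa_le (polyfun_cst 0) (polyfun_var 0).
apply: sa_imp.
  apply: sa_all_fin => i.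
  have p1 : polyfun (fun E => z (fun l => E (m + l).+2) 0 i : R).
    exact: (pz m.+2).
  have p2 : polyfun (fun E => (\row_j E j.+2) 0 i : R).
    by apply: polyfun_ext (polyfun_var i.+2) => E; rewrite mxE.
  apply: sa_and; apply: sa_le; try exact: (polyfun_var 0); exact: polyfun_sub.
apply: sa_imp.
  apply: (safam_subst sG); first exact: polyfun_var.
  by apply: polyvec_row => j; apply: polyfun_var.
apply: sa_le; first exact: polyfun_add (polyfun_cst _) (polyfun_var _).
apply: polyfun_add.
  apply: polyfun_add; first exact: polyfun_var.
  exact: polyfun_mul (polyfun_var _) (polyfun_var _).
apply: polyfun_mul; first exact: polyfun_cst.
exact: polyfun_mul (polyfun_var _) (polyfun_var _).
Qed.

Let closed_preimage (T U : topologicalType) (f : T -> U) (D : set U) :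
  continuous f -> closed D -> closed (f @^-1` D).
Proof. by move=> cf; apply: preimage_closed => x _; exact: cf. Qed.

(** For a lower semicontinuous function, being at level [c + r] need not be a closed condition. Here
    the upper half is a sublevel set, closed by [clG], and the slope condition, which supplies the
    lower half, is an intersection of inequalities continuous in the slope and the point. *)
Let closed_A r : closed (A r).
Proof.
have cc i : continuous (fun v : 'rV[R]_(1 + m) => v 0 i).
  by move=> v; exact: coord_continuous.
have cr : continuous (rsubmx : 'rV[R]_(1 + m) -> 'rV[R]_m).
  exact: continuous_rsubmx.
pose f w (v : 'rV[R]_(1 + m)) := v 0 (lshift m 0) * `|rsubmx v - w| +
  k * `|rsubmx v - w| ^+ 2.
have cf w : continuous (f w).
  have cn : continuous (fun v : 'rV[R]_(1 + m) => `|rsubmx v - w|).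
    by move=> v; exact: (cvg_norm (cvgB (cr v) (cvg_cst w))).
  move=> v.
  exact: (cvgD (cvgM (cc _ v) (cn v)) (cvgM (cvg_cst k) (cvgM (cn v) (cn v)))).
pose V := 'rV[R]_(1 + m).
have -> : A r =
    [set v : V | 0 <= v 0 (lshift m 0)] `&` [set v : V | v 0 (lshift m 0) <= M] `&`
    (\bigcap_(i in [set: 'I_m]) [set v : V | `|v 0 (rshift 1 i)| <= M]) `&`
    (rsubmx @^-1` [set z | exists2 s, G s z & s <= c + r]) `&`
    (\bigcap_(ws in [set ws : 'rV[R]_m * R | G ws.2 ws.1])
      (f ws.1 @^-1` [set x | c + r - ws.2 <= x])).
  apply/seteqP; split=> v.
    move=> [H1 H2 H3 [H4 H5]]; split.
      by split=> //; split=> // i _; exact: H3.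
    by move=> [w s] /= Gw; rewrite /f; have := H5 w s Gw; lra.
  move=> [[[[H1 H2] H3] H4] H5]; split=> //; first by move=> i; apply: H3.
  by split=> // w s Gw; have := H5 (w, s) Gw; rewrite /f /=; lra.
apply: closedI; last first.
  by apply: closed_bigI => ws _; apply: closed_preimage => //; exact: closed_ge.
apply: closedI; last first.
  by apply: closed_preimage; [exact: cr|exact: clG].
apply: closedI; last first.
  apply: closed_bigI => i _.
  apply: (@closed_preimage _ _ (fun v : 'rV[R]_(1 + m) => `|v 0 (rshift 1 i)|)
    [set x | x <= M]); last exact: closed_le.
  by move=> v; exact: (cvg_norm (cc _ v)).
apply: closedI.
  exact: (closed_preimage (cc _) (@closed_ge _ 0)).
exact: (closed_preimage (cc _) (@closed_le _ M)).
Qed.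

(** The lowest possible slope at level [c + r] is realised along a curve [u r]
    whose coordinates are eventually monotone in [r], so that their total
    variation [phi] desingularises [G]. *)
Lemma slope_desingularization : exists2 d, 0 < d & exists (phi : R -> R) (b : R),
  forall r z rho, 0 < r -> r < d -> 0 <= rho -> rho <= M -> `|z| <= M ->
    slope_le r z rho ->
    b <= phi r /\ forall s, 0 < s -> s <= r -> phi s <= phi r /\
      r - s <= rho * (phi r - phi s) + k * (phi r - phi s) ^+ 2.
Proof.
have bA r z : A r z -> forall i, `|z 0 i| <= M.
  move=> [z0 zM zi _] i; case: (split_ordP i) => j ->; last exact: zi.
  by rewrite (ord1 j) ger0_norm.
have [d d0 [em|[u [phi [b [uP phib uphi]]]]]] :=
    semialgebraic_selection (lshift m 0) sa_A closed_A bA.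
  (* Vacuous case: the given slope and point would belong to an empty fibre. *)
  exists d => //; exists (fun=> 0), 0 => r z rho r0 rd rho0 rhoM zM sl.
  case: (em r (row_mx (\row_(i < 1) rho) z) r0 rd); split.
  - by rewrite row_mxEl mxE.
  - by rewrite row_mxEl mxE.
  - by move=> i; rewrite row_mxEr; apply: le_trans zM; exact: coord_le_norm.
  - by rewrite row_mxKr row_mxEl mxE.
exists d => //; exists phi, b => r z rho r0 rd rho0 rhoM zM sl.
have [[ur0 urM uri [_ ursl]] urmin] := uP r r0 rd.
have ur_rho : u r 0 (lshift m 0) <= rho.
  have := urmin (row_mx (\row_(i < 1) rho) z); rewrite row_mxEl mxE; apply; split.
  - by rewrite row_mxEl mxE.
  - by rewrite row_mxEl mxE.
  - by move=> i; rewrite row_mxEr; apply: le_trans zM; exact: coord_le_norm.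
  - by rewrite row_mxKr row_mxEl mxE.
split; first exact: phib.
move=> s s0 sr.
have [[_ _ _ [[t Gt ts] _]] _] := uP s s0 (le_lt_trans sr rd).
have D0 : 0 <= phi r - phi s by apply: le_trans (uphi s r (lshift m 0) s0 sr rd).
split; first by rewrite -subr_ge0.
have Dz : `|rsubmx (u r) - rsubmx (u s)| <= phi r - phi s.
  by apply: rV_norm_le => // i; rewrite !mxE; apply: uphi.
(* The slope inequality at the point selected for [r] is tested at the one selected for [s], whose
   level is at most [c + s]. *)
have := ursl _ _ Gt.
have : u r 0 (lshift m 0) * `|rsubmx (u r) - rsubmx (u s)| <= rho * (phi r - phi s).
  by apply: ler_pM.
have : k * `|rsubmx (u r) - rsubmx (u s)| ^+ 2 <= k * (phi r - phi s) ^+ 2.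
  by rewrite ler_wpM2l// ler_sqr ?nnegrE.
lra.
Qed.

End Desingularization.

(** * Semialgebraic sets as semialgebraic predicates *)

Section Polynomials.
Context {R : realType}.

Lemma polyfun_meval m (p : mpoly.mpoly m R) (V : (nat -> R) -> 'rV[R]_m) :
  polyvec V -> polyfun (fun E => mpoly.meval (V E 0) p).
Proof.
move=> pV; apply: polyfun_ext (fun E => esym (mpoly.mevalE (V E 0) p)) _.
apply: polyfun_sum => mon; apply: polyfun_mul; first exact: polyfun_cst.
by apply: polyfun_prod => i; apply: polyfun_exp; exact: pV.
Qed.

Lemma sa_all_bool (T : Type) (b : T -> (nat -> R) -> bool) (s : seq T) :
  (forall c, sa (fun E => b c E)) -> sa (fun E => all (b ^~ E) s).
Proof.
move=> sb; elim: s => [|c s IH] /=; first exact: sa_cst.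
by apply: sa_ext _ (sa_and (sb c) IH) => E; split=> /andP.
Qed.

Lemma semialgebraic_set_sa m (A : set 'rV[R]_m) (V : (nat -> R) -> 'rV[R]_m) :
  semialgebraic_set A -> polyvec V -> sa (fun E => A (V E)).
Proof.
move=> [s ->] pV /=.
elim: s => [|c s IH] /=; first exact: sa_cst.
pose b1 p (E : nat -> R) := mpoly.meval (V E 0) p == 0.
pose b2 q (E : nat -> R) := 0 < mpoly.meval (V E 0) q.
have s1 : sa (fun E => all (b1 ^~ E) c.1).
  apply: sa_all_bool => p.
  apply: sa_ext _ (sa_eq (polyfun_meval p pV) (polyfun_cst 0)) => E.
  by split=> /eqP.
have s2 : sa (fun E => all (b2 ^~ E) c.2).
  by apply: sa_all_bool => q; exact: sa_lt (polyfun_cst 0) (polyfun_meval q pV).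
apply: sa_ext _ (sa_or (sa_and s1 s2) IH) => E; split.
  by move=> [[-> ->]//|->]; rewrite orbT.
by move=> /orP[/andP|]; [left|right].
Qed.

End Polynomials.

(** * Euclidean geometry and the proximal operator *)

Section EuclideanTheory.
Context {R : realType} {n : nat}.
Implicit Types (x y z p q : 'rV[R]_n) (a : R).

Lemma edotC x y : edot x y = edot y x.
Proof. by apply: eq_bigr => i _; rewrite mulrC. Qed.

Lemma edotDl x y z : edot (x + y) z = edot x z + edot y z.
Proof. by rewrite /edot -big_split; apply: eq_bigr => i _; rewrite mxE mulrDl. Qed.

Lemma edotZl a x y : edot (a *: x) y = a * edot x y.
Proof. by rewrite /edot mulr_sumr; apply: eq_bigr => i _; rewrite mxE mulrA. Qed.

Lemma edotNl x y : edot (- x) y = - edot x y.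
Proof. by rewrite -scaleN1r edotZl mulN1r. Qed.

Lemma edotBl x y z : edot (x - y) z = edot x z - edot y z.
Proof. by rewrite edotDl edotNl. Qed.

Lemma edotDr x y z : edot z (x + y) = edot z x + edot z y.
Proof. by rewrite edotC edotDl !(edotC z). Qed.

Lemma edotZr a x y : edot x (a *: y) = a * edot x y.
Proof. by rewrite edotC edotZl edotC. Qed.

Lemma edotNr x y : edot x (- y) = - edot x y.
Proof. by rewrite edotC edotNl edotC. Qed.

Lemma edotBr x y z : edot z (x - y) = edot z x - edot z y.
Proof. by rewrite edotDr edotNr. Qed.

Definition edotE := (edotDl, edotBl, edotDr, edotBr, edotZl, edotZr, edotNl, edotNr).

Lemma edot_ge0 x : 0 <= edot x x.
Proof. by apply: sumr_ge0 => i _; rewrite -expr2 sqr_ge0. Qed.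

Lemma enorm_ge0 x : 0 <= enorm x.
Proof. exact: sqrtr_ge0. Qed.

Lemma enorm_sqr x : enorm x ^+ 2 = edot x x.
Proof. by rewrite sqr_sqrtr// edot_ge0. Qed.

Lemma enorm0 : enorm (0 : 'rV[R]_n) = 0.
Proof. by rewrite /enorm -(scale0r 0) edotZl mul0r sqrtr0. Qed.

Lemma coord_le_enorm x i : `|x 0 i| <= enorm x.
Proof.
rewrite -(@ler_pXn2r _ 2)// ?nnegrE ?enorm_ge0// enorm_sqr real_normK ?num_real//.
rewrite /edot (bigD1 i)//= -expr2 lerDl.
by apply: sumr_ge0 => j _; rewrite -expr2 sqr_ge0.
Qed.

Lemma enorm_eq0 x : enorm x = 0 -> x = 0.
Proof.
move=> x0; apply/rowP => i; rewrite mxE; apply/normr0_eq0/le_anti.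
by rewrite normr_ge0 andbT -x0 coord_le_enorm.
Qed.

Lemma enormN x : enorm (- x) = enorm x.
Proof. by rewrite /enorm edotNl edotNr opprK. Qed.

Lemma enormB x y : enorm (x - y) = enorm (y - x).
Proof. by rewrite -enormN opprB. Qed.

Lemma enormZ a x : enorm (a *: x) = `|a| * enorm x.
Proof.
by rewrite /enorm edotZl edotZr mulrA -expr2 sqrtrM ?sqr_ge0// sqrtr_sqr.
Qed.

Lemma cauchy_schwarz x y : edot x y <= enorm x * enorm y.
Proof.
have [x0|x0] := eqVneq (enorm x) 0.
  by rewrite (enorm_eq0 x0) -(scale0r 0) edotZl mul0r mulr_ge0 ?enorm_ge0.
have [y0|y0] := eqVneq (enorm y) 0.
  by rewrite (enorm_eq0 y0) -(scale0r 0) edotZr mul0r mulr_ge0 ?enorm_ge0.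
have p : 0 < enorm x * enorm y by rewrite mulr_gt0// lt0r ?x0 ?y0 enorm_ge0.
rewrite -(ler_pM2l p).
have := edot_ge0 (enorm y *: x - enorm x *: y).
rewrite !edotE -!enorm_sqr (edotC y x); nra.
Qed.

Lemma cauchy_schwarzN x y : - (enorm x * enorm y) <= edot x y.
Proof. by rewrite lerNl -edotNl -(enormN x) cauchy_schwarz. Qed.

Lemma enormD x y : enorm (x + y) <= enorm x + enorm y.
Proof.
rewrite -(@ler_pXn2r _ 2)// ?nnegrE ?addr_ge0 ?enorm_ge0//.
rewrite enorm_sqr !edotE (edotC y x) -!enorm_sqr sqrrD.
have := cauchy_schwarz x y; lra.
Qed.

Lemma enorm_triangle z x y : enorm (x - y) <= enorm (x - z) + enorm (z - y).
Proof. by rewrite -[x - y](subrKA z) enormD. Qed.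

Lemma enorm_le_dist x y : enorm x - enorm y <= enorm (x - y).
Proof. by rewrite lerBlDr -{1}[x](subrK y) enormD. Qed.

(** Adding the two inequalities eliminates [a] and [b] and gives firm nonexpansiveness,
    [|p - q|^2 <= <x - y, p - q>]; Cauchy-Schwarz concludes. *)
Lemma nonexpansive_of_variational x y p q (a b k : R) : 0 < k ->
  a + edot (x - p) (q - p) * k <= b -> b + edot (y - q) (p - q) * k <= a ->
  enorm (p - q) <= enorm (x - y).
Proof.
move=> k0 H1 H2.
have H : edot (x - p) (q - p) + edot (y - q) (p - q) <= 0.
  by rewrite -(ler_pM2r k0) mul0r mulrDl; lra.
have [->|N0] := eqVneq (enorm (p - q)) 0; first exact: enorm_ge0.
have N : 0 < enorm (p - q) by rewrite lt0r N0 enorm_ge0.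
rewrite -(ler_pM2r N) -expr2; apply: le_trans (cauchy_schwarz _ _).
move: H; rewrite enorm_sqr !edotE !(edotC q) !(edotC p); lra.
Qed.

(** The factor [n + 1] dominates the sharp one, the square root of [n], and stays positive for
    [n = 0], so that it can be divided by. *)
Lemma enorm_le_norm x : enorm x <= n.+1%:R * `|x|.
Proof.
rewrite -(@ler_pXn2r _ 2)// ?nnegrE ?mulr_ge0 ?enorm_ge0//.
rewrite enorm_sqr exprMn.
apply: (@le_trans _ _ (\sum_(i < n) `|x| ^+ 2)).
  apply: ler_sum => i _; rewrite -expr2 -real_normK ?num_real//.
  by rewrite ler_sqr ?nnegrE// coord_le_norm.
rewrite sumr_const card_ord -[leLHS]mulr_natl ler_wpM2r ?sqr_ge0//.
by rewrite -natrX ler_nat; lia.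
Qed.

Lemma norm_le_enorm x : `|x| <= enorm x.
Proof. by apply: rV_norm_le; [exact: enorm_ge0|exact: coord_le_enorm]. Qed.

Lemma continuous_enorm : continuous (@enorm R n).
Proof.
move=> x; apply/(@cvgrPdist_le _ _ _ _ (nbhs_filter x)) => e e0.
have H : \forall y \near x, `|x - y| <= n.+1%:R^-1 * e.
  by apply: (@cvgr_dist_le _ _ _ (nbhs x) _ id) => //; rewrite mulr_gt0.
apply: filterS H => y; rewrite ler_pdivlMl// => xy.
have := le_trans (enorm_le_dist x y) (le_trans (enorm_le_norm _) xy).
rewrite distrC in xy.
have := le_trans (enorm_le_dist y x) (le_trans (enorm_le_norm _) xy).
by rewrite ler_norml; lra.
Qed.

End EuclideanTheory.

Section SmoothPart.
Context {R : realType} {n : nat}.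
Variables (g : 'rV[R]_n -> R) (beta : R).
Hypothesis g_diff : forall y, differentiable g y.
Hypothesis g_lip : forall y z, enorm (grad g y - grad g z) <= beta * enorm (y - z).

Lemma diff_grad y v : 'd g y v = edot (grad g y) v.
Proof.
rewrite {1}[v]row_sum_delta linear_sum; apply: eq_bigr => i _.
by rewrite linearZ /= mxE mulrC.
Qed.

Lemma is_derive_line (x v : 'rV[R]_n) (t : R) :
  is_derive t 1 (fun t => g (x + t *: v)) (edot (grad g (x + t *: v)) v).
Proof.
have dg := g_diff (x + t *: v).
have dv : derivable g (x + t *: v) v by exact: diff_derivable.
have E : (fun h : R => h^-1 *: (g (x + (h *: 1 + t) *: v) - g (x + t *: v))) =
    (fun h : R => h^-1 *: (g (h *: v + (x + t *: v)) - g (x + t *: v))).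
  apply/funext => h; congr (_ *: (g _ - _)).
  by rewrite scalerDl [h *: 1]mulr1 addrCA.
split; first by move: dv; rewrite /derivable /= -E.
by rewrite -diff_grad -deriveE// /derive /= -E.
Qed.

(** Replacing the usual [beta / 2] by [beta] spares an integration: the bound
    is read off the mean value theorem. *)
Lemma quadratic_bound x y :
  `|g y - g x - edot (grad g x) (y - x)| <= beta * enorm (y - x) ^+ 2.
Proof.
have c : {within `[0, 1], continuous (fun t : R => g (x + t *: (y - x)))}.
  apply: continuous_subspaceT => t.
  have [d _] := is_derive_line x (y - x) t.
  exact/differentiable_continuous/derivable1_diffP.
have [s] := MVT (@ltr01 R) (fun t _ => is_derive_line x (y - x) t) c.
rewrite in_itv /= => /andP[s0 s1].
rewrite scale1r scale0r addr0 subr0 mulr1 [x + (y - x)]addrC subrK => ->.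
rewrite -edotBl.
have L : enorm (grad g (x + s *: (y - x)) - grad g x) <= beta * enorm (y - x).
  apply: le_trans (g_lip _ _) _.
  rewrite addrAC subrr add0r enormZ gtr0_norm//.
  have b0 : 0 <= beta * enorm (y - x) by apply: le_trans (g_lip y x); exact: enorm_ge0.
  by rewrite mulrCA ler_piMl// ltW.
rewrite expr2 mulrA ler_norml; apply/andP; split.
  apply: le_trans (cauchy_schwarzN _ _).
  by rewrite lerN2 ler_wpM2r// enorm_ge0.
apply: le_trans (cauchy_schwarz _ _) _.
by rewrite ler_wpM2r// enorm_ge0.
Qed.

End SmoothPart.

Section LowerSemicontinuity.
Context {R : realType} {T : topologicalType}.

Lemma closed_sublevel (f : T -> \bar R) (q : T -> R) (a : R) :
  lower_semicontinuous f -> continuous q ->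
  closed [set z | (f z + (q z)%:E <= a%:E)%E].
Proof.
move=> lf cq; rewrite -openC openE => z /= /negP; rewrite -ltNge => az.
(* A real [b] separates the two summands: [b < f z] and [a - b < q z] both persist near [z]. *)
have [b [bf bq]] : exists b : R, (b%:E < f z)%E /\ a - b < q z.
  case: (f z) az => [r| |] //=; last first.
    by exists (a - q z + 1); rewrite ltry; split=> //; lra.
  rewrite -EFinD lte_fin => az; exists (r - (r + q z - a) / 2).
  by rewrite lte_fin; split; lra.
have [V zV VP] := lf z b bf.
have H : \forall w \near z, a - b < q w.
  exact: (@cvgr_gt _ _ (nbhs z) _ q (q z) (cq z) _ bq).
apply: filterS (filterI zV H) => w [Vw qw] /=; apply/negP; rewrite -ltNge.
have := VP w Vw; case: (f w) => [r| |] //=; last by rewrite addye ?ltry.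
by rewrite -EFinD !lte_fin => br; lra.
Qed.

Lemma lower_semicontinuous_comp (U : topologicalType) (f : T -> \bar R) (p : U -> T) :
  lower_semicontinuous f -> continuous p -> lower_semicontinuous (f \o p).
Proof.
move=> lf cp z a /(lf (p z))[V zV VP].
by exists (p @^-1` V) => [|w /VP//]; exact: cp.
Qed.

(** The nonempty sublevel sets below [L] generate a proper filter. A cluster point lies in all of
    them, as they are closed, and is therefore a minimiser. *)
Lemma compact_sublevel_argmin (J : T -> \bar R) (L : R) (u0 : T) :
  (forall u, J u != -oo%E) -> (forall a : R, closed [set u | (J u <= a%:E)%E]) ->
  compact [set u | (J u <= L%:E)%E] -> (J u0 <= L%:E)%E ->
  exists u, forall w, (J u <= J w)%E.
Proof.
move=> Jno clJ cK Ju0.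
pose B (a : R) := [set u | (J u <= a%:E)%E].
pose D := [set a : R | a <= L /\ B a !=set0].
have DL : D L by split=> //; exists u0.
have sB a b : a <= b -> B a `<=` B b.
  by move=> ab u /le_trans; apply; rewrite lee_fin.
have fF : Filter (filter_from D B).
  apply: filter_from_filter; first by exists L.
  move=> a b Da Db; have [ab|/ltW ba] := leP a b.
    by exists a => // u Bu; split=> //; apply: sB Bu.
  by exists b => // u Bu; split=> //; apply: sB Bu.
have pF : ProperFilter (filter_from D B).
  by apply: filter_from_proper => a [].
have [u [Ku uP]] : [set u | (J u <= L%:E)%E] `&` cluster (filter_from D B) !=set0.
  by apply: cK; exists L.
have uB a : D a -> B a u.
  move=> Da; apply: clJ => V uV; apply: uP => //.
  by exists a.
exists u => w; have [wL|/ltW wL] := leP (J w) L%:E; last exact: le_trans wL.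
have := Jno w; case Jw : (J w) wL => [r| |] //= rL _.
by apply: uB; split=> //; exists w; rewrite /B /= Jw.
Qed.

End LowerSemicontinuity.

Section Prox.
Context {R : realType} {n : nat}.
Variables (f : 'rV[R]_n -> \bar R) (g : 'rV[R]_n -> R) (beta eta : R).
Hypothesis f_proper : eproper f.
Hypothesis f_convex : econvex f.
Hypothesis f_lsc : lower_semicontinuous f.
Hypothesis g_diff : forall y, differentiable g y.
Hypothesis g_lip : forall y z, enorm (grad g y - grad g z) <= beta * enorm (y - z).
Hypothesis fg_bounded : bounded_below (fun y => (f y + (g y)%:E)%E).
Hypothesis eta_gt0 : 0 < eta.
Hypothesis eta_beta : 2 * eta * beta < 1.

Let J y u := (f u + ((2 * eta)^-1 * enorm (u - y) ^+ 2)%:E)%E.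

(** Coercivity comes from the lower bound [m] of [f + g]: [f u >= m - g u], and the quadratic bound
    on [g] at [y] leaves a growth of [(1 / (2 eta) - beta) |u - y|^2] against a linear term. *)
Lemma argmin_prox_nonempty y : argmin (J y) !=set0.
Proof.
have [fno [u0 fu0]] := f_proper.
have [m mfg] := fg_bounded.
have cq : continuous (fun u : 'rV[R]_n => (2 * eta)^-1 * enorm (u - y) ^+ 2).
  have ce : continuous (fun u : 'rV[R]_n => enorm (u - y)).
    move=> u.
    exact: (cvg_comp _ _ (cvgB cvg_id (cvg_cst y)) (@continuous_enorm R n (u - y))).
  by move=> u; exact: (cvgM (cvg_cst _) (cvgM (ce u) (ce u))).
have Jno u : J y u != -oo%E by rewrite /J; case: (f u) (fno u).
have [r0 Jr0] : exists r, J y u0 = r%:E.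
  rewrite /J; move: fu0 (fno u0); rewrite /edom /=; case: (f u0) => [r| |]// _ _.
  by eexists; rewrite -EFinD.
have clJ a : closed [set u | (J y u <= a%:E)%E] by apply: closed_sublevel.
have [||u uP] := @compact_sublevel_argmin _ _ (J y) r0 u0 Jno clJ; last by exists u.
  apply: bounded_closed_compact => //.
  pose dl := (2 * eta)^-1 - beta.
  have dl0 : 0 < dl.
    by rewrite subr_gt0 -[ltRHS]mul1r ltr_pdivlMr ?mulr_gt0// mulrC.
  pose b := enorm (grad g y); pose C := r0 - m + g y.
  pose S := 1 + (b + `|C|) / dl + `|y|.
  exists S; split; first exact: num_real.
  move=> S' SS' u /= Ju; rewrite (le_trans _ (ltW SS'))//.
  have uy : `|u| <= enorm (u - y) + `|y|.
    rewrite -[X in `|X|](subrK y) (le_trans (ler_normD _ _))// lerD2r.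
    exact: norm_le_enorm.
  apply: (le_trans uy); rewrite lerD2r.
  have b0 : 0 <= b by exact: enorm_ge0.
  have q0 : 0 <= (b + `|C|) / dl by apply: divr_ge0; [exact: addr_ge0|exact: ltW].
  have [N1|N1] := leP (enorm (u - y)) 1; first by rewrite (le_trans N1)// lerDl.
  apply: (@le_trans _ _ ((b + `|C|) / dl)); last by rewrite lerDr.
  rewrite ler_pdivlMr//.
  have [r fur] : exists r, f u = r%:E.
    move: Ju (fno u); rewrite /J; case: (f u) => [r| |]//.
    by move=> _ _; exists r.
  move: Ju (mfg u); rewrite /J fur -!EFinD !lee_fin => Ju mr.
  have := quadratic_bound g_diff g_lip y u; rewrite ler_norml => /andP[_ gu].
  have := cauchy_schwarz (grad g y) (u - y); rewrite -/b => cs.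
  have CC := ler_norm C.
  have key : dl * enorm (u - y) ^+ 2 <= b * enorm (u - y) + `|C|.
    by rewrite /dl /C in CC *; lra.
  have C0 : 0 <= `|C| by [].
  have : dl * enorm (u - y) ^+ 2 <= (b + `|C|) * enorm (u - y).
    by apply: (le_trans key); rewrite mulrDl lerD2l ler_peMr// ltW.
  have N0 : 0 < enorm (u - y) by exact: lt_trans N1.
  by rewrite expr2 mulrA ler_pM2r// mulrC.
by rewrite Jr0.
Qed.

Lemma prox_argmin y u : (J y (prox eta f y) <= J y u)%E.
Proof. exact: (getPex (argmin_prox_nonempty y)) u. Qed.

Lemma prox_fin y : exists r, f (prox eta f y) = r%:E.
Proof.
have [fno [u0 fu0]] := f_proper.
have := prox_argmin y u0; rewrite /J.
move: fu0 (fno u0) (fno (prox eta f y)); rewrite /edom /=.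
by case: (f u0) => [r| |]//; case: (f _) => [r'| |]//; exists r'.
Qed.

(** Comparing the minimiser [p] with [t u + (1 - t) p] and dividing by [t] leaves an error
    [t |u - p|^2 / (2 eta)], which vanishes with [t]. *)
Lemma prox_optimality y u :
  (f (prox eta f y) + (edot (y - prox eta f y) (u - prox eta f y) / eta)%:E <= f u)%E.
Proof.
set p := prox eta f y.
have [a fp] : exists a, f p = a%:E by exact: prox_fin.
have [fno _] := f_proper.
case fu : (f u) (fno u) => [b| |]// _; last by rewrite leey.
rewrite fp -EFinD lee_fin.
set e := edot _ _; set c := enorm (u - p) ^+ 2.
have ineq t : 0 < t -> t <= 1 -> a + e / eta <= b + t * ((2 * eta)^-1 * c).
  move=> t0 t1; pose w := t *: u + (1 - t) *: p.
  have wP : (f w <= (t * b + (1 - t) * a)%:E)%E.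
    have := @f_convex u p t; rewrite fu fp -!EFinM -EFinD; apply.
    by rewrite ltW.
  have := prox_argmin y w; rewrite -/p /J fp -EFinD.
  have wy : enorm (w - y) ^+ 2 = enorm (p - y) ^+ 2 - 2 * t * e + t ^+ 2 * c.
    have -> : w - y = (p - y) + t *: (u - p).
      by rewrite /w scalerBl scale1r scalerBr addrCA addrC; apply/rowP => i;
        rewrite !mxE; ring.
    have : edot (p - y) (u - p) = - e by rewrite /e -edotNl opprB.
    rewrite /c; move: (p - y) (u - p) => v1 v2 v12.
    by rewrite !enorm_sqr !edotE (edotC v2) v12; ring.
  rewrite wy; case: (f w) wP => [s| |]//; rewrite -EFinD !lee_fin => sP H.
  set k := (2 * eta)^-1 in H *.
  have ke : eta^-1 = 2 * k by rewrite /k invfM mulrA mulfV// mul1r.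
  rewrite ke -(ler_pM2l t0).
  nra.
apply/ler_addgt0Pr => eps eps0.
(* The [+ 1] keeps the denominator positive when [u = p]. *)
pose t := Num.min 1 (eps / ((2 * eta)^-1 * c + 1)).
have c0 : 0 <= (2 * eta)^-1 * c by rewrite mulr_ge0 ?sqr_ge0// invr_ge0 mulr_ge0// ltW.
have t0 : 0 < t by rewrite lt_min ltr01 divr_gt0// ltr_wpDl.
have t1 : t <= 1 by rewrite ge_min lexx.
apply: (le_trans (ineq t t0 t1)); rewrite lerD2l.
have : t <= eps / ((2 * eta)^-1 * c + 1) by rewrite ge_min lexx orbT.
rewrite ler_pdivlMr ?ltr_wpDl// => /(le_trans _); apply.
by rewrite ler_wpM2l ?(ltW t0)// lerDl.
Qed.

Lemma prox_optimality_fin y u a b : f (prox eta f y) = a%:E -> f u = b%:E ->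
  a + edot (y - prox eta f y) (u - prox eta f y) / eta <= b.
Proof. by move=> fa fb; have := prox_optimality y u; rewrite fa fb -EFinD lee_fin. Qed.

Lemma prox_nonexpansive y z : enorm (prox eta f y - prox eta f z) <= enorm (y - z).
Proof.
have [a fp] := prox_fin y; have [b fq] := prox_fin z.
apply: nonexpansive_of_variational (prox_optimality_fin fp fq)
  (prox_optimality_fin fq fp).
by rewrite invr_gt0.
Qed.

End Prox.

(** * Estimates with quadratic errors *)

Section RealLemmas.
Context {R : realType}.
Implicit Types (G N E psi l : R -> R) (a b K : R).

(** Over [m + 1] equal steps the errors add up to at most [|K| (b - a)^2 / (m + 1)], with [m]
    arbitrary. *)
Lemma nonincreasing_of_quadratic G a b K :
  (forall t s, a <= t -> t < s -> s <= b -> G s - G t <= K * (s - t) ^+ 2) ->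
  a <= b -> G b <= G a.
Proof.
move=> H ab.
have step m : G b - G a <= `|K| * (b - a) ^+ 2 / m.+1%:R.
  pose h := (b - a) / m.+1%:R.
  have m0 : 0 < m.+1%:R :> R by rewrite ltr0n.
  have [<-|ab'] := eqVneq a b; first by rewrite !subrr expr0n mulr0 mul0r.
  have {}ab' : a < b by rewrite lt_neqAle ab' ab.
  have h0 : 0 < h by rewrite divr_gt0// subr_gt0.
  have bE : b = a + m.+1%:R * h.
    by rewrite /h mulrC divfK ?gt_eqF// addrC subrK.
  have part k : (k <= m.+1)%N -> G (a + k%:R * h) - G a <= k%:R * (`|K| * h ^+ 2).
    elim: k => [_|k IH km]; first by rewrite !mul0r addr0 subrr.
    have := IH (ltnW km).
    have kE : k.+1%:R * h = k%:R * h + h by rewrite -natr1 mulrDl mul1r.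
    have := H (a + k%:R * h) (a + k.+1%:R * h).
    have -> : a + k.+1%:R * h - (a + k%:R * h) = h by rewrite kE; ring.
    have k0 : 0 <= k%:R * h by rewrite mulr_ge0// ltW.
    have kb : a + k.+1%:R * h <= b by rewrite bE lerD2l ler_pM2r// ler_nat.
    have kk : a + k%:R * h < a + k.+1%:R * h by rewrite kE; lra.
    have ak : a <= a + k%:R * h by lra.
    move=> /(_ ak kk kb) H1 H2.
    have : K * h ^+ 2 <= `|K| * h ^+ 2 by rewrite ler_wpM2r ?sqr_ge0// ler_norm.
    have -> : k.+1%:R * (`|K| * h ^+ 2) = k%:R * (`|K| * h ^+ 2) + `|K| * h ^+ 2.
      by rewrite -natr1; ring.
    lra.
  have := part m.+1 (leqnn _); rewrite -bE => /le_trans; apply.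
  rewrite /h expr_div_n le_eqVlt; apply/orP; left; apply/eqP.
  by field; rewrite gt_eqF.
rewrite -subr_le0; apply/ler_addgt0Pr => e e0; rewrite add0r.
pose C := `|K| * (b - a) ^+ 2.
apply: (le_trans (step (Num.truncn (C / e)))); rewrite -/C.
rewrite ler_pdivrMr ?ltr0n// mulrC -ler_pdivrMr//.
exact/ltW/truncnS_gt.
Qed.

(** Since [1 + L h <= exp (L h)], the function [exp (- L (t - a)) N t] is nonincreasing up to a
    quadratic error. For a speed [N]: once zero it stays zero, and a nonzero final value bounds it
    below on the whole interval. *)
Lemma gronwall_lower N a b (L K : R) : 0 <= L ->
  (forall t, 0 <= N t) ->
  (forall t s, a <= t -> t < s -> s <= b ->
     N s - N t <= L * (N t * (s - t)) + K * (s - t) ^+ 2) ->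
  a <= b -> expR (- L * (b - a)) * N b <= N a.
Proof.
move=> L0 N0 H ab.
pose G t := expR (- L * (t - a)) * N t.
suff : G b <= G a by rewrite /G subrr mulr0 expR0 mul1r.
apply: (@nonincreasing_of_quadratic G a b `|K|) => // t s a_t ts sb.
rewrite /G; set e1 := expR (- L * (s - a)); set e2 := expR (- L * (t - a)).
have e12 : e2 = e1 * expR (L * (s - t)).
  by rewrite /e1 /e2 -expRD; congr expR; ring.
have e1p : 0 < e1 by exact: expR_gt0.
have e1_le1 : e1 <= 1.
  rewrite /e1 -expR0 ler_expR mulNr oppr_le0 mulr_ge0//; lra.
have := expR_ge1Dx (L * (s - t)); set e3 := expR _ in e12 * => e3P.
have KN : K * (s - t) ^+ 2 <= `|K| * (s - t) ^+ 2.
  by rewrite ler_wpM2r ?sqr_ge0// ler_norm.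
have KN0 : 0 <= `|K| * (s - t) ^+ 2 by rewrite mulr_ge0 ?sqr_ge0.
have H1 := H t s a_t ts sb.
have : e1 * N s <= e1 * ((1 + L * (s - t)) * N t + `|K| * (s - t) ^+ 2).
  by rewrite ler_pM2l//; lra.
have : e1 * ((1 + L * (s - t)) * N t) <= e1 * (e3 * N t).
  by rewrite ler_pM2l// ler_wpM2r.
have : e1 * (`|K| * (s - t) ^+ 2) <= `|K| * (s - t) ^+ 2 by rewrite ler_piMl.
rewrite e12 mulrDr; lra.
Qed.

(** [N] is the speed, [E] the energy and [psi] the desingularised energy.  When [N]
    stays away from [0], the two bounds on [E t - E s] force [psi] to decrease at rate
    at least [al / C * N], up to a quadratic error. *)
Lemma length_bound N E psi l a b (al C kap V K K3 dl : R) :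
  0 < al -> 0 < C -> 0 <= kap -> 0 <= K -> 0 < dl ->
  (forall t, a <= t -> t <= b -> dl <= N t /\ N t <= V) ->
  (forall t s, a <= t -> t < s -> s <= b ->
     al * (N t ^+ 2 * (s - t)) - K * (s - t) ^+ 2 <= E t - E s) ->
  (forall t s, a <= t -> t < s -> s <= b -> psi s <= psi t /\
     E t - E s <= C * N t * (psi t - psi s) + kap * (psi t - psi s) ^+ 2) ->
  (forall t s, a <= t -> t < s -> s <= b ->
     l s - l t <= N t * (s - t) + K3 * (s - t) ^+ 2) ->
  a <= b -> l b - l a <= C / al * (psi a - psi b).
Proof.
move=> al0 C0 kap0 K0 dl0 NP dE klE lP ab.
have V0 : 0 < V by have [H1 H2] := NP a (lexx _) ab; lra.
pose q := al / C.
have q0 : 0 < q by rewrite divr_gt0.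
(* Chosen so that [C dl K1] equals the total quadratic error met below; dividing by [dl] is where a
   positive lower bound on the speed enters. *)
pose K1 := (K + kap * (q * V) ^+ 2) / (C * dl).
have K1E : K1 * (C * dl) = K + kap * (q * V) ^+ 2.
  by rewrite /K1 divfK// gt_eqF// mulr_gt0.
have K10 : 0 <= K1.
  apply: divr_ge0; last by rewrite mulr_ge0// ltW.
  by rewrite addr_ge0// mulr_ge0// sqr_ge0.
have psiP t s : a <= t -> t < s -> s <= b ->
    q * (N t * (s - t)) - K1 * (s - t) ^+ 2 <= psi t - psi s.
  (* By contradiction: if the decrease [D] of [psi] is too small, then [D <= q V (s - t)], so
     [kap D^2] is itself a quadratic error and the bounds on the energy conflict. *)
  move=> a_t ts sb; rewrite leNgt; apply/negP => lt.
  have [D0 kl] := klE t s a_t ts sb.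
  have d := dE t s a_t ts sb.
  have [N1 N2] := NP t a_t (ltW (lt_le_trans ts sb)).
  move: (psi t - psi s) (subr_ge0 (psi s) (psi t)) kl lt => D; rewrite D0 => D0' kl lt.
  have h0 : 0 < s - t by rewrite subr_gt0.
  move: (s - t) h0 d lt => h h0 d lt; move: (N t) N1 N2 d lt kl => Nt N1 N2 d lt kl.
  have Nt0 : 0 < Nt by lra.
  have h20 : 0 <= K1 * h ^+ 2 by rewrite mulr_ge0 ?sqr_ge0.
  have Dq : D <= q * V * h.
    have : q * (Nt * h) <= q * (V * h) by rewrite ler_pM2l// ler_pM2r.
    lra.
  have kD : kap * D ^+ 2 <= kap * (q * V) ^+ 2 * h ^+ 2.
    rewrite -mulrA -exprMn ler_wpM2l// ler_sqr ?nnegrE//.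
    by apply/ltW/mulr_gt0 => //; exact: mulr_gt0.
  have CN0 : 0 < C * Nt by rewrite mulr_gt0.
  have : C * Nt * D < C * Nt * (q * (Nt * h) - K1 * h ^+ 2) by rewrite ltr_pM2l.
  have -> : C * Nt * (q * (Nt * h) - K1 * h ^+ 2) =
      al * (Nt ^+ 2 * h) - C * Nt * (K1 * h ^+ 2).
    have -> : al = C * q by rewrite /q mulrC divfK// gt_eqF.
    ring.
  have : C * dl * (K1 * h ^+ 2) <= C * Nt * (K1 * h ^+ 2).
    by rewrite ler_wpM2r// ler_pM2l.
  have -> : C * dl * (K1 * h ^+ 2) = (K + kap * (q * V) ^+ 2) * h ^+ 2.
    by rewrite -K1E; ring.
  lra.
pose G t := psi t + q * l t.
have : G b <= G a.
  apply: (@nonincreasing_of_quadratic G a b (K1 + q * K3)) => // t s a_t ts sb.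
  have H1 := psiP t s a_t ts sb.
  have : q * (l s - l t) <= q * (N t * (s - t) + K3 * (s - t) ^+ 2).
    by rewrite ler_pM2l//; exact: lP.
  by rewrite /G; lra.
rewrite /G => GH; rewrite -(ler_pM2l q0) mulrA.
have -> : q * (C / al) = 1 by rewrite /q; field; rewrite !gt_eqF.
lra.
Qed.

End RealLemmas.

(** * Calculus and integration on the half-line *)

Section HalfLineCalculus.
Context {R : realType} {n : nat}.
Implicit Types (t s e : R) (i : 'I_n).
Variables (x : R -> 'rV[R]_n).
Hypothesis x_derivable : forall t, 0 <= t -> derivable0y x t.

Lemma derive0y_dist t e : 0 <= t -> 0 < e -> exists2 d, 0 < d &
  forall s, 0 <= s -> s != t -> `|s - t| < d ->
    `|derive0y x t - (s - t)^-1 *: (x s - x t)| <= e.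
Proof.
move=> t0 e0; have /cvgrPdist_le/(_ _ e0) H := x_derivable t0.
have /nbhs_ballP[d /= d0 dP] : nbhs t (fun s => s != t -> s \in `[0, +oo[ ->
  `|derive0y x t - quotient0y x t s| <= e) by exact: H.
exists d => // s s0 st std; apply: dP => //=.
  by rewrite /ball /= distrC.
by rewrite in_itv /= s0.
Qed.

Lemma is_derive_coord t i : 0 < t ->
  is_derive t 1 (fun s => x s 0 i) (derive0y x t 0 i).
Proof.
move=> t0.
suff H : h^-1 *: (x (h *: 1 + t) 0 i - x t 0 i) @[h --> 0^'] --> derive0y x t 0 i.
  by split; [apply/cvg_ex; exists (derive0y x t 0 i)|exact: cvg_lim H].
apply/cvgrPdist_le => e e0.
have [d d0 dP] := derive0y_dist (ltW t0) e0.
(* A radius below [t] keeps [h + t] positive, where the one-sided quotient is controlled. *)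
have [e' e'0 [e'd e't]] := pos_lt2 d0 t0.
apply/nbhs_ballP; exists e' => //= h.
rewrite /ball /= sub0r normrN => he' h0.
have := dP (h + t); rewrite addrK.
have ht : - t < h by move: he'; rewrite ltr_norml => /andP[? _]; lra.
have -> : (h + t != t) = true by rewrite -subr_eq0 addrK.
move=> /(_ _ isT (lt_trans he' e'd)); rewrite -lerBlDr sub0r => /(_ (ltW ht)) H.
rewrite [h *: 1]mulr1; apply: le_trans H.
by have := coord_le_norm (derive0y x t - h^-1 *: (x (h + t) - x t)) i; rewrite !mxE.
Qed.

Lemma coord_right_continuous t i : 0 <= t -> x s 0 i @[s --> t^'+] --> x t 0 i.
Proof.
move=> t0; apply/cvgrPdist_le => e e0.
have [d d0 dP] := derive0y_dist t0 (@ltr01 R).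
pose B := `|derive0y x t| + 1.
have B0 : 0 < B by rewrite /B ltr_wpDl.
have [e' e'0 [e'd e'B]] := pos_lt2 d0 (divr_gt0 e0 B0).
apply/nbhs_ballP; exists e' => //= s; rewrite /ball /= distrC => se' ts.
have st : s != t by rewrite gt_eqF.
have := dP s (ltW (le_lt_trans t0 ts)) st (lt_trans se' e'd) => H.
have {}H : `|(s - t)^-1 *: (x s - x t)| <= B.
  move: H; set q := _ *: _ => H.
  have := lerB_dist q (derive0y x t); rewrite distrC /B; lra.
have st0 : 0 < s - t by rewrite subr_gt0.
have H1 : `|x s - x t| <= B * (s - t).
  rewrite mulrC -ler_pdivrMl// -[X in X * _]gtr0_norm ?invr_gt0//.
  by rewrite -normrZ.
apply: (@le_trans _ _ (B * (s - t))).
  apply: le_trans H1; rewrite [leRHS]distrC.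
  by have := coord_le_norm (x t - x s) i; rewrite !mxE.
move: e'B; rewrite ltr_pdivlMr// => e'B.
move: se'; rewrite gtr0_norm// => se'.
have : B * (s - t) < B * e' by rewrite ltr_pM2l.
lra.
Qed.

(** Stated per coordinate, as the mean value equality fails for vectors. At [t = 0] the path is only
    right-continuous, its past values being arbitrary. *)
Lemma coord_MVT t s i : 0 <= t -> t < s -> exists c, [/\ t < c, c < s &
  x s 0 i - x t 0 i = derive0y x c 0 i * (s - t)].
Proof.
move=> t0 ts.
have dx c : t < c -> {for c, continuous (fun s => x s 0 i)}.
  move=> tc; have [d _] := is_derive_coord i (le_lt_trans t0 tc).
  exact/differentiable_continuous/derivable1_diffP.
have [c| |c] := @MVT R (fun s => x s 0 i) (fun s => derive0y x s 0 i) t s ts.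
- by rewrite in_itv /= => /andP[tc _]; apply/is_derive_coord/(le_lt_trans t0).
- apply/(continuous_within_itvP _ ts); split.
  + by move=> c; rewrite in_itv /= => /andP[tc _]; exact: dx.
  + exact: coord_right_continuous.
  + by apply: cvg_at_left_filter; exact: dx.
by rewrite in_itv /= => /andP[tc cs] E; exists c.
Qed.

End HalfLineCalculus.

Section HalfLineIntegral.
Context {R : realType}.
Local Notation mu := (@lebesgue_measure R).
Variables (N : R -> R).
Hypothesis N_cont : {within `[0, +oo[, continuous N}.

Lemma within_halfline_integrable (b : R) : mu.-integrable `[0, b] (EFin \o N).
Proof.
apply: continuous_compact_integrable; first exact: segment_compact.
apply: continuous_subspaceW N_cont => t /=.
by rewrite !in_itv /= => /andP[-> _].
Qed.

Lemma Rintegral_increment_le (t s B : R) : 0 <= t -> t < s ->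
  (forall r, t <= r -> r <= s -> N r <= B) ->
  Rintegral mu `[0, s] N - Rintegral mu `[0, t] N <= B * (s - t).
Proof.
move=> t0 ts NB.
rewrite Rintegral_itvB ?bnd_simp//; [|exact: within_halfline_integrable|exact: ltW].
have muE : mu `]t, s] = (s - t)%:E.
  by rewrite lebesgue_measure_itv /= lte_fin ts -EFinB.
have sub : `]t, s]%classic `<=` (`[0, s]%classic : set R).
  by move=> r /=; rewrite !in_itv /= => /andP[tr ->]; rewrite (ltW (le_lt_trans t0 tr)).
have cB : mu.-integrable `[0, s] (EFin \o cst B).
  apply: continuous_compact_integrable; first exact: segment_compact.
  by apply: continuous_subspaceT => r; exact: cvg_cst.
apply: (@le_trans _ _ (Rintegral mu `]t, s] (cst B))).
  apply: le_Rintegral => //.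
  - exact: integrableS (within_halfline_integrable s).
  - exact: integrableS cB.
  - by move=> r /=; rewrite in_itv /= => /andP[/ltW tr rs]; apply: NB.
rewrite Rintegral_cst// le_eqVlt; apply/orP; left; apply/eqP; congr (_ * _).
exact: (congr1 fine muE).
Qed.

Hypothesis N_ge0 : forall t, 0 <= N t.

(** Monotone convergence along the intervals [[0, k]]. *)
Lemma integrable_halfline (a B : R) :
  (forall b, a <= b -> Rintegral mu `[0, b] N <= B) ->
  mu.-integrable `[0, +oo[ (EFin \o N).
Proof.
move=> NB.
have mN : measurable_fun (`[0, +oo[ : set R) N.
  by apply: subspace_continuous_measurable_fun.
have mEN : measurable_fun (`[0, +oo[ : set R) (EFin \o N) by exact/measurable_EFinP.
apply/integrableP; split; first exact: mEN.
have -> : (\int[mu]_(t in `[0%R, +oo[) `|(EFin \o N) t| =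
    \int[mu]_(t in `[0%R, +oo[) (N t)%:E)%E.
  by apply: eq_integral => t _; rewrite /= ger0_norm.
pose I (k : nat) : set R := `[0, k%:R]%classic.
have UE : `[0, +oo[%classic = \bigcup_k I k.
  apply/seteqP; split=> t /=; rewrite in_itv /= andbT.
    move=> t0; exists (Num.truncn t).+1 => //.
    by rewrite /I /= in_itv /= t0 ltW// truncnS_gt.
  by move=> [k _]; rewrite /I /= in_itv /= => /andP[].
have sub k : I k `<=` `[0, +oo[%classic.
  by move=> t; rewrite /I /= !in_itv /= => /andP[-> _].
have cvgN : (\int[mu]_(t in I k) (N t)%:E)%E @[k --> \oo] -->
    (\int[mu]_(t in \bigcup_k I k) (N t)%:E)%E.
  apply: ge0_nondecreasing_set_cvg_integral => //.
  - move=> k l kl; apply/subsetPset => t; rewrite /I /= !in_itv /=.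
    move=> /andP[-> /le_trans]; apply.
    by rewrite ler_nat.
  - by move=> k; exact: measurable_itv.
  - by move=> k; apply: measurable_funS mEN => //; exact: measurable_itv.
  - by move=> k t _; rewrite lee_fin.
rewrite UE; apply: (@le_lt_trans _ _ B%:E); last exact: ltry.
rewrite -(cvg_lim _ cvgN)//; apply: lime_le.
  by apply/cvg_ex; eexists; exact: cvgN.
exists (Num.truncn a).+1 => // k /= ak.
have := NB k%:R; rewrite /Rintegral -lee_fin fineK.
  by apply; rewrite (le_trans (ltW (truncnS_gt _)))// ler_nat.
exact: integrable_fin_num (within_halfline_integrable k%:R).
Qed.

End HalfLineIntegral.

Section Subdifferential.
Context {R : realType} {n : nat}.
Implicit Types (h : 'rV[R]_n -> \bar R) (p w u : 'rV[R]_n).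

Lemma frechet_subdiff_of_quadratic h p w (K a : R) : 0 <= K -> h p = a%:E ->
  (forall u, ((a + edot w (u - p) - K * enorm (u - p) ^+ 2)%:E <= h u)%E) ->
  frechet_subdiff h p w.
Proof.
move=> K0 hp H; split; first by rewrite /edom /= hp ltry.
rewrite limf_einfE; apply/lee_addgt0Pr => e e0.
(* Makes [K |u - p|^2 <= e |u - p|] on the ball; the factor [n + 1] converts its sup-norm radius to
   the Euclidean norm. *)
pose d := e / ((K + 1) * n.+1%:R).
have K1 : 0 < K + 1 by rewrite ltr_wpDl.
have d0 : 0 < d by rewrite divr_gt0// mulr_gt0// ltr0n.
pose V := [set u : 'rV[R]_n | `|p - u| < d /\ u <> p].
have VF : p^' V.
  apply/nbhs_ballP; exists d => //= u pu up; split=> //; last exact/eqP.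
  by move: pu; rewrite -ball_normE.
suff : (- e%:E <= ereal_inf ((fun y => (h y - h p - (edot w (y - p))%:E) *
    ((enorm (y - p))^-1)%:E)%E @` V))%E.
  rewrite leeNl => le.
  have : (ereal_inf ((fun y => (h y - h p - (edot w (y - p))%:E) *
    ((enorm (y - p))^-1)%:E)%E @` V) <= ereal_sup [set ereal_inf ((fun y =>
    (h y - h p - (edot w (y - p))%:E) * ((enorm (y - p))^-1)%:E)%E @` V) | V in p^'])%E.
    by apply: ereal_sup_ubound; exists V.
  move=> le2; rewrite -leeBlDr// sub0e.
  by apply: le_trans le2; rewrite leeNl.
apply: le_ereal_inf_tmp => _ [u [pu up] <-].
have N0 : 0 < enorm (u - p).
  rewrite lt0r enorm_ge0 andbT; apply/eqP => /enorm_eq0/eqP; rewrite subr_eq0.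
  by move/eqP.
have Nd : (K + 1) * enorm (u - p) <= e.
  apply: (@le_trans _ _ ((K + 1) * (n.+1%:R * d))).
    rewrite ler_pM2l// (le_trans (enorm_le_norm _))// ler_pM2l ?ltr0n//.
    by rewrite distrC ltW.
  by rewrite mulrA /d mulrC divfK// gt_eqF// mulr_gt0// ltr0n.
have := H u; rewrite hp; case: (h u) => [b| |]//; last first.
  by move=> _; rewrite /= mulyr gtr0_sg ?invr_gt0// mul1e leey.
rewrite lee_fin -!EFinB -EFinM -EFinN lee_fin => Hb.
rewrite ler_pdivlMr//.
have : (K + 1) * enorm (u - p) * enorm (u - p) <= e * enorm (u - p).
  by rewrite ler_pM2r.
have := sqr_ge0 (enorm (u - p)).
lra.
Qed.

End Subdifferential.

(** * The forward-backward trajectory *)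

Section Trajectory.
Context {R : realType} {n : nat}.
Variables (f : 'rV[R]_n -> \bar R) (g : 'rV[R]_n -> R) (beta eta : R).
Variable (x : R -> 'rV[R]_n).
Hypothesis f_proper : eproper f.
Hypothesis f_convex : econvex f.
Hypothesis f_lsc : lower_semicontinuous f.
Hypothesis g_diff : forall y, differentiable g y.
Hypothesis beta_ge0 : 0 <= beta.
Hypothesis g_lip : forall y z, enorm (grad g y - grad g z) <= beta * enorm (y - z).
Hypothesis fg_bounded : bounded_below (fun y => (f y + (g y)%:E)%E).
Hypothesis eta_gt0 : 0 < eta.
Hypothesis eta_beta : eta * beta * (3 + eta * beta) < 1.
Hypothesis x_C1 : C1_0y x.
Hypothesis x_ode : forall t : R, 0 <= t ->
  derive0y x t + x t = prox eta f (x t - eta *: grad g (x t)).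
Hypothesis x_bounded : exists M : R, forall t : R, 0 <= t -> enorm (x t) <= M.
Hypothesis fg_semialg : semialgebraic_fun (fun y => (f y + (g y)%:E)%E).
Implicit Types (t s : R) (y z u : 'rV[R]_n).

(** [fb] stands for forward-backward: an explicit gradient step on [g], then a proximal step on
    [f]. *)
Definition fb_point t := prox eta f (x t - eta *: grad g (x t)).
Definition fb_velocity t := fb_point t - x t.
Definition fb_energy t :=
  fine (f (fb_point t)) + g (fb_point t) + (2 * eta)^-1 * enorm (fb_velocity t) ^+ 2.

Local Notation p := fb_point.
Local Notation v := fb_velocity.
Local Notation H := fb_energy.
Local Notation eb := (eta * beta).

Let eb_ge0 : 0 <= eb. Proof. by rewrite mulr_ge0// ltW. Qed.
Let eb_lt : 3 * eb < 1.
Proof. by have := mulr_ge0 eb_ge0 eb_ge0; have := eta_beta; lra. Qed.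
Let eta_beta2 : 2 * eta * beta < 1.
Proof. by have := eb_lt; have := eb_ge0; lra. Qed.

Lemma derive0yE t : 0 <= t -> derive0y x t = v t.
Proof. by move=> /x_ode; rewrite /fb_velocity /fb_point => <-; rewrite addrK. Qed.

Lemma fb_point_fin t : f (p t) = (fine (f (p t)))%:E.
Proof.
have [r] := prox_fin f_proper f_lsc g_diff g_lip fg_bounded eta_gt0 eta_beta2
  (x t - eta *: grad g (x t)).
by rewrite -/(p t) => ->.
Qed.

Lemma fb_point_lipschitz s t : enorm (p s - p t) <= (1 + eb) * enorm (x s - x t).
Proof.
apply: le_trans (prox_nonexpansive f_proper f_convex f_lsc g_diff g_lip
  fg_bounded eta_gt0 eta_beta2 _ _) _.
have -> : x s - eta *: grad g (x s) - (x t - eta *: grad g (x t)) =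
    (x s - x t) - eta *: (grad g (x s) - grad g (x t)).
  move: (grad g (x s)) (grad g (x t)) => a b.
  by apply/rowP => i; rewrite !mxE; ring.
apply: le_trans (enormD _ _) _; rewrite enormN enormZ (gtr0_norm eta_gt0).
have : eta * enorm (grad g (x s) - grad g (x t)) <= eta * (beta * enorm (x s - x t)).
  by rewrite ler_pM2l.
lra.
Qed.

Lemma fb_velocity_lipschitz s t : enorm (v s - v t) <= (2 + eb) * enorm (x s - x t).
Proof.
have -> : v s - v t = (p s - p t) - (x s - x t).
  rewrite /fb_velocity; move: (p s) (p t) => a b.
  by apply/rowP => i; rewrite !mxE; ring.
apply: le_trans (enormD _ _) _; rewrite enormN.
have := fb_point_lipschitz s t; lra.
Qed.

Lemma fb_velocity_bounded : exists2 V, 0 < V & forall t, 0 <= t -> enorm (v t) <= V.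
Proof.
have [M xM] := x_bounded.
have M0 : 0 <= M by apply: le_trans (xM 0 (lexx _)); exact: enorm_ge0.
exists (enorm (v 0) + (2 + eb) * (M + M) + 1).
  by rewrite ltr_wpDl// addr_ge0 ?enorm_ge0// mulr_ge0 ?addr_ge0.
move=> t t0; have := enorm_le_dist (v t) (v 0).
have : (2 + eb) * enorm (x t - x 0) <= (2 + eb) * (M + M).
  rewrite ler_wpM2l ?addr_ge0// (le_trans (enormD _ _))// enormN lerD//.
  exact: xM. exact: xM.
have := fb_velocity_lipschitz t 0; lra.
Qed.

Let rV_enorm_le z (B : R) : 0 <= B -> (forall i, `|z 0 i| <= B) ->
  enorm z <= n.+1%:R * B.
Proof.
move=> B0 zB; apply: le_trans (enorm_le_norm _) _.
by rewrite ler_pM2l ?ltr0n// rV_norm_le.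
Qed.

Lemma x_lipschitz : exists2 K, 0 <= K &
  forall t s, 0 <= t -> t < s -> enorm (x s - x t) <= K * (s - t).
Proof.
have [V V0 vV] := fb_velocity_bounded.
exists (n.+1%:R * V) => [|t s t0 ts]; first by rewrite mulr_ge0// ltW.
have st : 0 < s - t by rewrite subr_gt0.
rewrite -mulrA; apply: rV_enorm_le => [|i]; first by rewrite mulr_ge0// ltW.
have [c [tc cs E]] := coord_MVT x_C1.1 i t0 ts.
rewrite !mxE E normrM (gtr0_norm st) ler_pM2r//.
have c0 : 0 <= c by apply: le_trans t0 (ltW tc).
rewrite derive0yE//; apply: le_trans (vV c c0); exact: coord_le_enorm.
Qed.

(** The velocity is a Lipschitz function of the position, which is Lipschitz in time. So a [C^1]
    solution has the Taylor remainder of a [C^{1,1}] curve. *)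
Lemma x_quadratic : exists2 K, 0 <= K & forall t s, 0 <= t -> t < s ->
  enorm (x s - x t - (s - t) *: v t) <= K * (s - t) ^+ 2.
Proof.
have [K K0 xK] := x_lipschitz.
exists (n.+1%:R * ((2 + eb) * K)) => [|t s t0 ts].
  by rewrite !mulr_ge0// addr_ge0.
have st : 0 < s - t by rewrite subr_gt0.
have L0 : 0 <= (2 + eb) * K by rewrite mulr_ge0// addr_ge0.
rewrite -mulrA; apply: rV_enorm_le => [|i]; first by rewrite mulr_ge0// sqr_ge0.
have [c [tc cs E]] := coord_MVT x_C1.1 i t0 ts.
have c0 : 0 <= c by apply: le_trans t0 (ltW tc).
have -> : (x s - x t - (s - t) *: v t) 0 i = (v c - v t) 0 i * (s - t).
  move: E; rewrite derive0yE//; move: (v c) (v t) => a b.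
  by rewrite !mxE => ->; ring.
rewrite normrM (gtr0_norm st) expr2 mulrA ler_pM2r//.
apply: le_trans (coord_le_enorm _ _) _.
apply: le_trans (fb_velocity_lipschitz _ _) _.
rewrite -mulrA ler_wpM2l ?addr_ge0//; apply: le_trans (xK t c t0 tc) _.
by rewrite ler_wpM2l// lerD2r ltW.
Qed.

(** Subgradient inequality for the Lyapunov function
    [(u, y) |-> f u + g u + |u - y|^2 / (2 eta)] at the point [(p t, x t)]. *)
Lemma fb_energy_le t u y b : f u = b%:E ->
  H t + edot (grad g (p t) - grad g (x t)) (u - p t) - eta^-1 * edot (v t) (y - x t)
    - beta * enorm (u - p t) ^+ 2
  <= b + g u + (2 * eta)^-1 * enorm (u - y) ^+ 2.
Proof.
move=> fu; have := prox_optimality f_proper f_convex f_lsc g_diff g_lip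
  fg_bounded eta_gt0 eta_beta2 (x t - eta *: grad g (x t)) u.
rewrite -/(p t) fb_point_fin fu -EFinD lee_fin => opt.
have := quadratic_bound g_diff g_lip (p t) u; rewrite ler_norml => /andP[gu _].
rewrite /fb_energy; move: (fine _) opt => a opt.
have vE : x t - eta *: grad g (x t) - p t = - v t - eta *: grad g (x t).
  rewrite /fb_velocity; move: (p t) (grad g (x t)) => a' b'.
  by apply/rowP => i; rewrite !mxE; ring.
have uyE : u - y = v t + ((u - p t) - (y - x t)).
  rewrite /fb_velocity; move: (p t) => a'.
  by apply/rowP => i; rewrite !mxE; ring.
rewrite vE in opt; rewrite uyE.
move: opt gu; rewrite /= !(edotBl _ _ (u - p t)).
rewrite -/(v t); move: (grad g (p t)) (grad g (x t)) (v t) (g (p t)) => G1 G2 vt gp.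
move: (u - p t) (y - x t) => D Y; rewrite edotNl edotZl mulrBl => opt gu.
have ke : eta^-1 = 2 * (2 * eta)^-1 by rewrite invfM mulrA mulfV// mul1r.
have etaK : eta * edot G2 D / eta = edot G2 D.
  by rewrite mulrAC mulfV ?mul1r// gt_eqF.
rewrite etaK ke in opt; rewrite ke.
have k0 : 0 < (2 * eta)^-1 by rewrite invr_gt0 mulr_gt0.
have -> : enorm (vt + (D - Y)) ^+ 2 = enorm vt ^+ 2 +
    2 * edot vt D - 2 * edot vt Y + enorm (D - Y) ^+ 2.
  have := edotBr D Y vt; move: (D - Y) => W DY.
  by rewrite !enorm_sqr edotDl !edotDr (edotC W) DY; ring.
move: ((2 * eta)^-1) k0 opt => k k0 opt.
have : 0 <= k * enorm (D - Y) ^+ 2 by rewrite mulr_ge0 ?sqr_ge0// ltW.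
lra.
Qed.

(** The subgradient inequality at the later time [s] is tested at [(p t, x t)]. To first order in
    [h = s - t], the term in [y] gains [|v t|^2 h / eta] and the gradient mismatch costs at most
    [beta (1 + eta beta) |v t|^2 h]; the condition on [eta] makes the difference positive. *)
Lemma fb_energy_descent : exists al K, [/\ 0 < al, 0 <= K &
  forall t s, 0 <= t -> t < s ->
    al * (enorm (v t) ^+ 2 * (s - t)) - K * (s - t) ^+ 2 <= H t - H s].
Proof.
have [V V0 vV] := fb_velocity_bounded.
have [K1 K10 xK1] := x_lipschitz.
have [K2 K20 xK2] := x_quadratic.
pose L := (2 + eb) * K1.
have L0 : 0 <= L by rewrite mulr_ge0// addr_ge0.
have ei0 : 0 < eta^-1 by rewrite invr_gt0.
pose c1 := beta * (1 + eb).
have c10 : 0 <= c1 by rewrite mulr_ge0// addr_ge0.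
pose K := eta^-1 * (L * V + V * K2) + c1 * (V * K2 + L * K1)
  + beta * ((1 + eb) * K1) ^+ 2.
exists (eta^-1 - c1), K; split.
- rewrite subr_gt0 -[ltRHS]mul1r ltr_pdivlMr// /c1.
  have -> : beta * (1 + eb) * eta = eb + eb * eb by ring.
  have := mulr_ge0 eb_ge0 eb_ge0; have := eb_ge0; have := eta_beta.
  by rewrite mulrDr; lra.
- have V0' := ltW V0; have ei0' := ltW ei0.
  by do ![exact: sqr_ge0 | done | apply: addr_ge0 | apply: mulr_ge0].
move=> t s t0 ts.
have h0 : 0 < s - t by rewrite subr_gt0.
have s0 : 0 <= s by apply: le_trans t0 (ltW ts).
have := fb_energy_le s (x t) (fb_point_fin t); rewrite -/(v t) -/(H t).
set h := s - t in h0 *.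
set N := enorm (v t); have NV : N <= V by exact: vV.
have N0 : 0 <= N by exact: enorm_ge0.
set w := x s - x t - h *: v t.
have wK : enorm w <= K2 * h ^+ 2 by exact: xK2.
have xE : x t - x s = - (h *: v t + w).
  by rewrite /w; move: (v t) => a; apply/rowP => i; rewrite !mxE; ring.
have xst : enorm (x s - x t) <= K1 * h by exact: xK1.
have vst : enorm (v s - v t) <= L * h.
  apply: le_trans (fb_velocity_lipschitz _ _) _.
  by rewrite -mulrA ler_wpM2l ?addr_ge0.
have xstN : enorm (x s - x t) <= N * h + K2 * h ^+ 2.
  have -> : x s - x t = h *: v t + w by rewrite /w [RHS]addrC subrK.
  apply: le_trans (enormD _ _) _; rewrite enormZ (gtr0_norm h0) -/N; lra.
have vsN : enorm (v s) <= N + L * h.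
  by have := enorm_le_dist (v s) (v t); rewrite -/N; lra.
have e1 : N ^+ 2 * h - (L * V + V * K2) * h ^+ 2 <= - edot (v s) (x t - x s).
  rewrite xE edotNr opprK edotDr edotZr.
  have : - (V * (K2 * h ^+ 2)) <= edot (v s) w.
    apply: le_trans (cauchy_schwarzN _ _); rewrite lerN2.
    by apply: ler_pM => //; [exact: enorm_ge0|exact: enorm_ge0|exact: vV].
  have : h * (N ^+ 2 - L * h * V) <= h * edot (v s) (v t).
    rewrite ler_pM2l// /N enorm_sqr.
    have -> : edot (v s) (v t) = edot (v s - v t) (v t) + edot (v t) (v t).
      by rewrite edotBl subrK.
    have : - (L * h * V) <= edot (v s - v t) (v t).
      apply: le_trans (cauchy_schwarzN _ _); rewrite lerN2.
      by apply: ler_pM => //; exact: enorm_ge0.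
    lra.
  lra.
have e2 : - (c1 * (N ^+ 2 * h + (V * K2 + L * K1) * h ^+ 2)) <=
    edot (grad g (p s) - grad g (x s)) (p t - p s).
  apply: le_trans (cauchy_schwarzN _ _); rewrite lerN2.
  have : enorm (grad g (p s) - grad g (x s)) * enorm (p t - p s) <=
      beta * enorm (v s) * ((1 + eb) * enorm (x s - x t)).
    apply: ler_pM; [exact: enorm_ge0|exact: enorm_ge0|exact: g_lip|].
    by rewrite enormB; exact: fb_point_lipschitz.
  move=> /le_trans; apply.
  have -> : beta * enorm (v s) * ((1 + eb) * enorm (x s - x t)) =
    c1 * (enorm (v s) * enorm (x s - x t)) by rewrite /c1; ring.
  rewrite ler_wpM2l//.
  have : enorm (v s) * enorm (x s - x t) <= (N + L * h) * enorm (x s - x t).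
    by rewrite ler_wpM2r// enorm_ge0.
  have : N * enorm (x s - x t) <= N * (N * h + K2 * h ^+ 2) by rewrite ler_wpM2l.
  have : L * h * enorm (x s - x t) <= L * h * (K1 * h).
    by rewrite ler_wpM2l// mulr_ge0// ltW.
  have : N * (K2 * h ^+ 2) <= V * (K2 * h ^+ 2).
    by rewrite ler_wpM2r// mulr_ge0// sqr_ge0.
  lra.
have e3 : beta * enorm (p t - p s) ^+ 2 <= beta * ((1 + eb) * K1) ^+ 2 * h ^+ 2.
  rewrite -mulrA -exprMn ler_wpM2l// ler_sqr ?nnegrE ?enorm_ge0//; last first.
    by have h0' := ltW h0; do ![done | apply: addr_ge0 | apply: mulr_ge0].
  rewrite enormB; apply: le_trans (fb_point_lipschitz _ _) _.
  by rewrite -mulrA ler_wpM2l ?addr_ge0.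
have e1' : eta^-1 * (N ^+ 2 * h - (L * V + V * K2) * h ^+ 2) <=
  eta^-1 * (- edot (v s) (x t - x s)) by rewrite ler_pM2l.
rewrite /K; lra.
Qed.

Lemma fb_velocity_gronwall : exists2 L, 0 <= L & forall t s, 0 <= t -> t <= s ->
  expR (- L * (s - t)) * enorm (v s) <= enorm (v t).
Proof.
have [K K0 xK] := x_quadratic.
have L0 : 0 <= 2 + eb by rewrite addr_ge0.
exists (2 + eb) => // t s t0 ts.
apply: (@gronwall_lower _ (fun t => enorm (v t)) t s _ ((2 + eb) * K)) => //.
  by move=> r; exact: enorm_ge0.
move=> r q tr rq qs.
have h0 : 0 < q - r by rewrite subr_gt0.
have : enorm (x q - x r) <= enorm (v r) * (q - r) + K * (q - r) ^+ 2.
  rewrite -[x q - x r](subrK ((q - r) *: v r)).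
  apply: le_trans (enormD _ _) _; rewrite addrC enormZ (gtr0_norm h0) mulrC lerD2l.
  exact: xK (le_trans t0 tr) rq.
move=> /(ler_wpM2l L0); have := fb_velocity_lipschitz q r.
have := enorm_le_dist (v q) (v r); lra.
Qed.

Lemma fb_energy_bounded : exists m, forall t, m <= H t.
Proof.
have [m fgm] := fg_bounded; exists m => t; have := fgm (p t).
rewrite fb_point_fin -EFinD lee_fin => /le_trans; apply.
by rewrite lerDl mulr_ge0 ?sqr_ge0// invr_ge0 mulr_ge0// ltW.
Qed.

Lemma fb_energy_nonincreasing t s : 0 <= t -> t <= s -> H s <= H t.
Proof.
have [al [K [al0 K0 Hd]]] := fb_energy_descent.
move=> t0 ts; apply: (@nonincreasing_of_quadratic _ H t s K) => // r q tr rq _.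
have := Hd r q (le_trans t0 tr) rq.
have : 0 <= al * (enorm (v r) ^+ 2 * (q - r)).
  apply: mulr_ge0; first exact: ltW.
  by apply: mulr_ge0; [exact: sqr_ge0 | rewrite subr_ge0 ltW].
lra.
Qed.

Definition lyapunov_graph (r : R) (z : 'rV[R]_(n + n)) := exists2 b,
  f (lsubmx z) = b%:E &
  r = b + g (lsubmx z) + (2 * eta)^-1 * enorm (lsubmx z - rsubmx z) ^+ 2.

(** Subtracting the quadratic term from the level is a polynomial substitution that sends the graph
    of [F] into that of [f + g]. *)
Lemma safam_lyapunov_graph : safam lyapunov_graph.
Proof.
pose z (E : nat -> R) : 'rV[R]_(n + n) := \row_i E i.+1.
pose q (E : nat -> R) := (2 * eta)^-1 * enorm (lsubmx (z E) - rsubmx (z E)) ^+ 2.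
pose V E := row_mx (lsubmx (z E)) (\row_(_ < 1) (E 0%N - q E)).
apply: (@sa_ext _ (fun E => finite_graph (fun y => (f y + (g y)%:E)%E) (V E))).
  move=> E; rewrite /finite_graph /= /V row_mxKl row_mxKr mxE /lyapunov_graph -/(z E).
  rewrite -/(q E); move: (q E) (lsubmx (z E)) => c l; split.
    case: (f l) => [b| |]// [bE]; exists b => //; lra.
  by move=> [b -> ->]; rewrite -EFinD addrK.
apply: semialgebraic_set_sa => // i; rewrite /V.
have zi j : polyfun (fun E => z E 0 j).
  by apply: polyfun_ext (polyfun_var j.+1) => E; rewrite mxE.
case: (split_ordP i) => j ->.
  by apply: polyfun_ext (zi (lshift n j)) => E; rewrite row_mxEl [RHS]mxE.
have pq : polyfun q.
  apply: polyfun_mul; first exact: polyfun_cst.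
  apply: (@polyfun_ext _ (fun E => \sum_(k < n)
    (z E 0 (lshift n k) - z E 0 (rshift n k)) *
    (z E 0 (lshift n k) - z E 0 (rshift n k)))).
    by move=> E; rewrite enorm_sqr; apply: eq_bigr => k _; rewrite !mxE.
  by apply: polyfun_sum => k; apply: polyfun_mul; apply: polyfun_sub.
apply: (@polyfun_ext _ (fun E => E 0%N - q E)).
  by move=> E; rewrite row_mxEr mxE.
exact: polyfun_sub (polyfun_var 0) pq.
Qed.

Lemma continuous_smooth_part : continuous g.
Proof. by move=> y; exact: differentiable_continuous (g_diff y). Qed.

Lemma closed_lyapunov_sublevel a :
  closed [set z | exists2 s, lyapunov_graph s z & s <= a].
Proof.
pose Z := 'rV[R]_(n + n).
have cl : continuous (lsubmx : Z -> 'rV[R]_n) by exact: continuous_lsubmx.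
have cr : continuous (rsubmx : Z -> 'rV[R]_n) by exact: continuous_rsubmx.
pose q (z : Z) := g (lsubmx z) + (2 * eta)^-1 * enorm (lsubmx z - rsubmx z) ^+ 2.
have cq : continuous q.
  have ce : continuous (fun z : Z => enorm (lsubmx z - rsubmx z)).
    move=> z.
    exact: (cvg_comp _ _ (cvgB (cl z) (cr z)) (@continuous_enorm R n _)).
  have cg : continuous (fun z : Z => g (lsubmx z)).
    by move=> z; exact: (cvg_comp _ _ (cl z) (@continuous_smooth_part (lsubmx z))).
  move=> z; exact: (cvgD (cg z) (cvgM (cvg_cst _) (cvgM (ce z) (ce z)))).
have -> : [set z | exists2 s, lyapunov_graph s z & s <= a] =
    [set z : Z | ((f \o lsubmx) z + (q z)%:E <= a%:E)%E].
  apply/seteqP; split=> z /=.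
    by move=> [s [b -> ->]] sa; rewrite -EFinD lee_fin /q addrA.
  have [fno _] := f_proper; move: (fno (lsubmx z)).
  rewrite /lyapunov_graph /q; case: (f (lsubmx z)) => [b| |]// _.
  by rewrite -EFinD lee_fin addrA => ba; eexists; [exists b|exact: ba].
by apply: closed_sublevel => //; exact: lower_semicontinuous_comp.
Qed.

(** The coefficients of the subgradient inequality: [beta] for the gradient mismatch, [1 / eta] for
    the term in [y]. Powers of [n + 1] convert Euclidean norms to the sup norm of [slope_le]. *)
Definition slope_cst : R := (beta + eta^-1) * n.+1%:R.
Definition curvature_cst : R := beta * n.+1%:R ^+ 2.

Lemma slope_le_trajectory c t :
  slope_le lyapunov_graph curvature_cst c (H t - c) (row_mx (p t) (x t))
    (slope_cst * enorm (v t)).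
Proof.
have cH : c + (H t - c) = H t by rewrite addrC subrK.
split.
  exists (H t); last by rewrite cH.
  by exists (fine (f (p t))); rewrite row_mxKl ?row_mxKr// fb_point_fin.
move=> w s [b fb ->]; rewrite cH.
have := fb_energy_le t (rsubmx w) fb.
set D := lsubmx w - p t; set Y := rsubmx w - x t.
set W := `|row_mx (p t) (x t) - w|; set m : R := n.+1%:R.
have m0 : 0 < m by rewrite ltr0n.
have W0 : 0 <= W by exact: normr_ge0.
have DW : enorm D <= m * W.
  apply: le_trans (enorm_le_norm _) _; rewrite ler_pM2l//.
  apply: rV_norm_le => // i.
  have -> : D 0 i = - (row_mx (p t) (x t) - w) 0 (lshift n i).
    rewrite /D; move: (p t) (x t) => a' b'.
    rewrite mxE [fun_of_matrix (row_mx a' b' - w) 0 _]mxE row_mxEl.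
    rewrite [fun_of_matrix (lsubmx w) 0 i]mxE [fun_of_matrix (- a') 0 i]mxE.
    by rewrite [fun_of_matrix (- w) 0 _]mxE opprB.
  by rewrite normrN coord_le_norm.
have YW : enorm Y <= m * W.
  apply: le_trans (enorm_le_norm _) _; rewrite ler_pM2l//.
  apply: rV_norm_le => // i.
  have -> : Y 0 i = - (row_mx (p t) (x t) - w) 0 (rshift n i).
    rewrite /Y; move: (p t) (x t) => a' b'.
    rewrite mxE [fun_of_matrix (row_mx a' b' - w) 0 _]mxE row_mxEr.
    rewrite [fun_of_matrix (rsubmx w) 0 i]mxE [fun_of_matrix (- b') 0 i]mxE.
    by rewrite [fun_of_matrix (- w) 0 _]mxE opprB.
  by rewrite normrN coord_le_norm.
have N0 := enorm_ge0 (v t).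
have e1 : - (beta * enorm (v t) * (m * W)) <=
    edot (grad g (p t) - grad g (x t)) D.
  apply: le_trans (cauchy_schwarzN _ _); rewrite lerN2.
  by apply: ler_pM; [exact: enorm_ge0|exact: enorm_ge0|exact: g_lip|].
have e2 : eta^-1 * edot (v t) Y <= eta^-1 * (enorm (v t) * (m * W)).
  rewrite ler_pM2l ?invr_gt0//; apply: le_trans (cauchy_schwarz _ _) _.
  by rewrite ler_wpM2l.
have e3 : beta * enorm D ^+ 2 <= curvature_cst * W ^+ 2.
  rewrite /curvature_cst -mulrA -exprMn ler_wpM2l// ler_sqr ?nnegrE ?enorm_ge0//.
  by rewrite mulr_ge0// ltW.
have -> : slope_cst * enorm (v t) * W =
    beta * enorm (v t) * (m * W) + eta^-1 * (enorm (v t) * (m * W)).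
  by rewrite /slope_cst -/m; ring.
move: e1 e2 e3; move: (edot _ D) (edot _ Y) => a1 a2.
lra.
Qed.

(** Quantified over every [l] growing at most at speed [|v|], to serve both for the integral of the
    speed (integrability) and for the distance to a fixed point of the path (Cauchy property). *)
Lemma finite_length : exists T psi b C, [/\ 0 <= T, 0 <= C,
  forall t, T <= t -> b <= psi t,
  forall t s, T <= t -> t <= s -> psi s <= psi t &
  forall l K a c, T <= a -> a <= c ->
    (forall t s, a <= t -> t < s -> s <= c ->
      l s - l t <= enorm (v t) * (s - t) + K * (s - t) ^+ 2) ->
    l c - l a <= C * (psi a - psi c)].
Proof.
have [L L0 vL] := fb_velocity_gronwall.
(* If the velocity vanishes once, it vanishes from then on, and a constant [psi] suffices. *)
have [[T [T0 vT]]|v_neq0] := pselect (exists T, 0 <= T /\ enorm (v T) = 0).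
  have v0 t : T <= t -> enorm (v t) = 0.
    move=> Tt; apply/le_anti; rewrite enorm_ge0 andbT.
    by have := vL T t T0 Tt; rewrite vT pmulr_rle0// expR_gt0.
  exists T, (fun=> 0), 0, 0; split=> // l K a c Ta ac lP.
  rewrite mul0r subr_le0; apply: (@nonincreasing_of_quadratic _ l a c K) => //.
  move=> t s at_ ts sc.
  by have := lP t s at_ ts sc; rewrite v0 ?mul0r ?add0r// (le_trans Ta).
have v_gt0 t : 0 <= t -> 0 < enorm (v t).
  by move=> t0; rewrite lt0r enorm_ge0 andbT; apply/eqP => vt; apply: v_neq0; exists t.
have [V V0 vV] := fb_velocity_bounded.
have [al [K1 [al0 K10 Hd]]] := fb_energy_descent.
have [m mH] := fb_energy_bounded.
pose S := [set H t | t in `[0, +oo[].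
have S0 t : 0 <= t -> S (H t) by move=> t0; exists t => //=; rewrite in_itv /= t0.
have infS : has_inf S.
  by split; [exists (H 0); exact: S0|exists m => _ [t _ <-]; exact: mH].
pose c := inf S.
have cH t : 0 <= t -> c <= H t by move=> t0; apply: ge_inf; [case: infS|exact: S0].
(* Desingularisation requires a positive level [H t - c]. If the infimum were attained, the energy
   would be constant afterwards, while a nonzero velocity forces a decrease over the short time
   [h]. *)
have cltH t : 0 <= t -> c < H t.
  move=> t0; rewrite lt_neqAle cH// andbT; apply/eqP => ct.
  have Hc s : t <= s -> H s = c.
    move=> ts; apply/le_anti; rewrite {1}ct fb_energy_nonincreasing//=.
    exact/cH/(le_trans t0).
  pose e := al * enorm (v t) ^+ 2.
  have e0 : 0 < e by rewrite mulr_gt0// exprn_gt0// v_gt0.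
  pose h := e / (K1 + 1).
  have h0 : 0 < h by rewrite divr_gt0// ltr_wpDl.
  have := Hd t (t + h) t0; rewrite ltrDl => /(_ h0).
  have Hth : H (t + h) = c by apply: Hc; rewrite lerDl ltW.
  rewrite (Hc t (lexx t)) Hth subrr [t + h]addrC addrK mulrA -/e => H1.
  have eE : e = h * (K1 + 1) by rewrite /h divfK// gt_eqF// ltr_wpDl.
  have : e * h <= K1 * h * h by rewrite -mulrA -expr2; lra.
  rewrite ler_pM2r// eE; lra.
have k0 : 0 <= curvature_cst by rewrite mulr_ge0// sqr_ge0.
have C0 : 0 < slope_cst.
  by rewrite mulr_gt0 ?ltr0n// ltr_wpDl// invr_gt0.
have [M xM] := x_bounded.
pose B := Num.max (slope_cst * V) (M + V).
have [d d0 [phi [b phiP]]] := slope_desingularization c B k0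
  safam_lyapunov_graph closed_lyapunov_sublevel.
(* From [T] on, the energy is within [d] of its infimum, the range in which [phi] is controlled. *)
have [_ [T T0 <-] HT] := inf_adherent d0 infS.
move: T0; rewrite /= in_itv /= andbT => T0; rewrite -/c in HT.
have xB t : 0 <= t -> `|row_mx (p t) (x t)| <= B.
  move=> t0; have xM0 := xM t t0; have vV0 := vV t t0.
  have MV0 : 0 <= M + V by have := enorm_ge0 (x t); lra.
  apply: (@le_trans _ _ (M + V)); last by rewrite le_max lexx orbT.
  apply: rV_norm_le => // i; case: (split_ordP i) => j ->.
    rewrite row_mxEl; apply: le_trans (coord_le_enorm _ _) _.
    have -> : p t = x t + v t by rewrite /fb_velocity addrC subrK.
    by apply: le_trans (enormD _ _) _; exact: lerD.
  rewrite row_mxEr; apply: le_trans (coord_le_enorm _ _) _; lra.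
have phiT t : T <= t -> b <= phi (H t - c) /\ forall s, 0 < s -> s <= H t - c ->
    phi s <= phi (H t - c) /\ H t - c - s <= slope_cst * enorm (v t) *
      (phi (H t - c) - phi s) + curvature_cst * (phi (H t - c) - phi s) ^+ 2.
  move=> Tt; have t0 := le_trans T0 Tt.
  apply: (phiP _ (row_mx (p t) (x t))) => //.
  - by rewrite subr_gt0 cltH.
  - by have := fb_energy_nonincreasing T0 Tt; lra.
  - by rewrite mulr_ge0 ?enorm_ge0// ltW.
  - by rewrite le_max ler_pM2l// vV.
  - exact: xB.
  - exact: slope_le_trajectory.
exists T, (fun t => phi (H t - c)), b, (slope_cst / al); split=> //.
- by rewrite divr_ge0// ltW.
- by move=> t /phiT[].
- move=> t s Tt ts; have [_ /(_ (H s - c))] := phiT t Tt.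
  case=> //; first by rewrite subr_gt0 cltH// (le_trans T0)// (le_trans Tt).
  by rewrite lerD2r fb_energy_nonincreasing// (le_trans T0).
move=> l K a e Ta ae lP.
have a0 := le_trans T0 Ta; have e0 := le_trans a0 ae.
(* The lower bound on the speed, from Gronwall, degenerates as [e] grows, but the conclusion does
   not contain it. *)
apply: (@length_bound _ (fun t => enorm (v t)) H (fun t => phi (H t - c)) l a e
  al slope_cst curvature_cst V K1 K (expR (- L * (e - a)) * enorm (v e))) => //.
- by rewrite mulr_gt0 ?expR_gt0 ?v_gt0.
- move=> t at_ te; have t0 := le_trans a0 at_; split; last exact: vV.
  apply: le_trans (vL t e t0 te); rewrite ler_wpM2r ?enorm_ge0//.
  rewrite ler_expR !mulNr lerN2 ler_wpM2l//; lra.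
- by move=> t s at_ ts _; apply: Hd => //; exact: le_trans at_.
- move=> t s at_ ts se; have t0 := le_trans a0 at_.
  have [_ /(_ (H s - c))] := phiT t (le_trans Ta at_).
  have -> : H t - c - (H s - c) = H t - H s by ring.
  apply; first by rewrite subr_gt0 cltH// (le_trans t0)// ltW.
  by rewrite lerD2r fb_energy_nonincreasing// ltW.
Qed.
Lemma derive0y_coord_measurable i :
  measurable_fun (`[0, +oo[ : set R) (fun t => derive0y x t 0 i).
Proof.
apply: subspace_continuous_measurable_fun; first exact: measurable_itv.
move=> t; exact: (cvg_comp _ _ (x_C1.2 t) (@coord_continuous _ _ _ 0 i _)).
Qed.

(** * Integrability of the velocity and convergence to a critical point *)

Lemma derive0y_L1 : L1_0y (derive0y x).
Proof.
split; first exact: derive0y_coord_measurable.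
pose N t := enorm (derive0y x t).
have cN : {within `[0, +oo[, continuous N}.
  by move=> t; exact: (cvg_comp _ _ (x_C1.2 t) (@continuous_enorm R n _)).
have [T [psi [b [C [T0 C0 psib psi_ni len]]]]] := finite_length.
have [K K0 xK] := x_lipschitz.
pose l t := Rintegral (@lebesgue_measure R) `[0, t] N.
apply: (@integrable_halfline _ N cN _ T (l T + C * (psi T - b))) => [t|c Tc].
  exact: enorm_ge0.
have : l c - l T <= C * (psi T - psi c).
  apply: (len l ((2 + eb) * K)) => // t s Tt ts _.
  have t0 := le_trans T0 Tt.
  have L0 : 0 <= (2 + eb) * K by rewrite mulr_ge0// addr_ge0.
  have H1 r : t <= r -> r <= s -> N r <= enorm (v t) + (2 + eb) * K * (s - t).
    move=> tr rs; rewrite /N derive0yE ?(le_trans t0)//.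
    have := enorm_le_dist (v r) (v t).
    have [<-|tr'] := eqVneq t r.
      have : 0 <= (2 + eb) * K * (s - t) by rewrite mulr_ge0// subr_ge0 ltW.
      by rewrite subrr; lra.
    have {tr'}tr : t < r by rewrite lt_neqAle tr' tr.
    have := fb_velocity_lipschitz r t.
    have : (2 + eb) * enorm (x r - x t) <= (2 + eb) * (K * (s - t)).
      rewrite ler_wpM2l ?addr_ge0// (le_trans (xK t r t0 tr))// ler_wpM2l//.
      by rewrite lerD2r.
    lra.
  have := Rintegral_increment_le cN t0 ts H1; rewrite -/(l s) -/(l t).
  by rewrite expr2; lra.
have : C * (psi T - psi c) <= C * (psi T - b).
  by rewrite ler_wpM2l// lerD2l lerN2 psib.
rewrite -/(l c); lra.
Qed.

Lemma trajectory_cauchy e : 0 < e -> exists2 A, 0 <= A &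
  forall t, A <= t -> enorm (x t - x A) <= e.
Proof.
move=> e0; have [T [psi [b [C [T0 C0 psib psi_ni len]]]]] := finite_length.
have [K K0 xK] := x_quadratic.
pose S := [set psi t | t in [set t | T <= t]].
have infS : has_inf S.
  by split; [exists (psi T), T => /=|exists b => _ [t Tt <-]; exact: psib].
have C10 : 0 < C + 1 by rewrite ltr_wpDl.
(* After [A], [psi] can drop by less than [e / (C + 1)]; [C] itself may be 0. *)
have [_ [A TA <-] HA] := inf_adherent (divr_gt0 e0 C10) infS.
exists A; first exact: le_trans TA.
move=> t At.
have := len (fun s => enorm (x s - x A)) K A t TA At.
rewrite subrr enorm0 subr0 => H1.
apply: le_trans (H1 _) _ => {H1}.
  move=> r s Ar rs _; have r0 := le_trans (le_trans T0 TA) Ar.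
  have := enorm_triangle (x r) (x s) (x A).
  have : enorm (x s - x r) <= enorm (v r) * (s - r) + K * (s - r) ^+ 2.
    rewrite -[x s - x r](subrK ((s - r) *: v r)).
    apply: le_trans (enormD _ _) _; rewrite addrC enormZ gtr0_norm ?subr_gt0//.
    by rewrite mulrC lerD2l; exact: xK.
  lra.
have infP : inf S <= psi t.
  by apply: ge_inf; [case: infS|exists t => //=; exact: le_trans At].
have D0 : 0 <= psi A - psi t by rewrite subr_ge0 psi_ni.
apply: (@le_trans _ _ ((C + 1) * (psi A - psi t))); first by rewrite ler_wpM2r// lerDl.
by rewrite mulrC -ler_pdivlMr//; lra.
Qed.

Lemma cvg_pinfty_enorm (F : R -> 'rV[R]_n) u :
  (forall e, 0 < e -> exists A, forall t, A <= t -> enorm (F t - u) <= e) ->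
  F t @[t --> +oo] --> u.
Proof.
move=> FP; apply/cvgrPdist_le => e /FP[A AP].
exists A; split; first exact: num_real.
by move=> t /ltW/AP; apply: le_trans; rewrite distrC norm_le_enorm.
Qed.

Lemma trajectory_cvg : exists u, x t @[t --> +oo] --> u.
Proof.
apply/cvg_ex/cauchy_cvgP/cauchy_exP => e e0.
have [A A0 AP] := trajectory_cauchy (divr_gt0 e0 (@ltr0n R 2)).
exists (x A), A; split; first exact: num_real.
move=> t /ltW/AP H1; rewrite -ball_normE /ball_ /= distrC.
by apply: le_lt_trans (norm_le_enorm _) _; lra.
Qed.

(** On [[A, A + 1]] the path moves by at most [e'], so the mean value theorem gives, for each
    coordinate, a time [c] at which that coordinate of the velocity is small. It stays small after
    [A], since the velocity is Lipschitz in the position. *)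
Lemma fb_velocity_cvg0 : v t @[t --> +oo] --> (0 : 'rV[R]_n).
Proof.
apply: cvg_pinfty_enorm => e e0.
pose L := 2 + eb; have L0 : 0 <= L by rewrite addr_ge0.
pose m : R := n.+1%:R; have m0 : 0 < m by rewrite ltr0n.
pose e' := e / (m * (1 + 2 * L)).
have L1 : 0 < 1 + 2 * L by rewrite ltr_wpDr// mulr_ge0.
have e'0 : 0 < e' by rewrite divr_gt0// mulr_gt0.
have [A A0 AP] := trajectory_cauchy e'0.
exists A => t At; rewrite subr0.
apply: (@le_trans _ _ (m * ((1 + 2 * L) * e'))); last first.
  by rewrite mulrA /e' mulrC divfK// gt_eqF// mulr_gt0.
have A1 : A < A + 1 by rewrite ltrDl.
apply: rV_enorm_le => [|i]; first by rewrite mulr_ge0 ?ltW.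
have [c [Ac cA1 E]] := coord_MVT x_C1.1 i A0 A1.
have c0 : 0 <= c by rewrite (le_trans A0)// ltW.
have vc : `|v c 0 i| <= e'.
  move: E; rewrite derive0yE// [A + 1]addrC addrK mulr1 => <-.
  apply: le_trans (AP _ (ltW A1)); rewrite [A + 1]addrC.
  by have := coord_le_enorm (x (1 + A) - x A) i; rewrite !mxE.
have vtc : `|(v t - v c) 0 i| <= L * (e' + e').
  apply: le_trans (coord_le_enorm _ _) _.
  apply: le_trans (fb_velocity_lipschitz _ _) _; rewrite ler_wpM2l//.
  apply: le_trans (enorm_triangle (x A) _ _) _; rewrite lerD ?AP//.
  by rewrite enormB AP// ltW.
have -> : v t 0 i = v c 0 i + (v t - v c) 0 i.
  by move: (v t) (v c) => a a'; rewrite !mxE addrC subrK.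
by apply: le_trans (ler_normD _ _) _; lra.
Qed.

(** Optimality of [p t] makes [- v t / eta - grad g (x t)] a subgradient of [f] there; adding
    [grad g (p t)] gives one of [f + g]. *)
Definition fb_subgradient t := grad g (p t) - grad g (x t) - eta^-1 *: v t.
Local Notation w := fb_subgradient.
Local Notation h := (fun y => (f y + (g y)%:E)%E).

Lemma fb_value_fin t : h (p t) = (fine (f (p t)) + g (p t))%:E.
Proof. by rewrite /= {1}fb_point_fin -EFinD. Qed.

Lemma fb_subgradient_le t u :
  ((fine (f (p t)) + g (p t) + edot (w t) (u - p t)
    - beta * enorm (u - p t) ^+ 2)%:E <= h u)%E.
Proof.
have [fno _] := f_proper.
case fu : (f u) (fno u) => [b| |]// _; last by rewrite addye// leey.
rewrite -EFinD lee_fin.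
(* With [y = u - v t] the penalty [|u - y|^2] equals the one in [H t], and both cancel. *)
have := fb_energy_le t (u - v t) fu.
have -> : u - v t - x t = u - p t.
  by rewrite /fb_velocity opprB addrA addrAC addrK.
have -> : u - (u - v t) = v t by rewrite opprB addrC subrK.
rewrite /fb_energy /fb_subgradient [edot (_ - _ - _) _]edotBl edotZl.
move: (edot _ _) (edot _ _) (g (p t)) (fine _) => a1 a2 a3 a4.
lra.
Qed.

Lemma fb_subgradient_bound t : enorm (w t) <= (beta + eta^-1) * enorm (v t).
Proof.
apply: le_trans (enormD _ _) _; rewrite enormN enormZ gtr0_norm ?invr_gt0//.
by rewrite mulrDl lerD2r; exact: g_lip.
Qed.

Lemma trajectory_cvg_crit u : x t @[t --> +oo] --> u -> crit h u.
Proof.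
move=> xu.
have pu : p t @[t --> +oo] --> u.
  have -> : p = (fun t => x t + v t).
    by apply/funext => t; rewrite /fb_velocity addrC subrK.
  by rewrite -[u]addr0; exact: (cvgD xu fb_velocity_cvg0).
have vN : enorm (v t) @[t --> +oo] --> (0 : R).
  rewrite -(@enorm0 R n).
  exact: (cvg_comp _ _ fb_velocity_cvg0 (@continuous_enorm R n 0)).
have wN : enorm (w t) @[t --> +oo] --> (0 : R).
  apply: (@squeeze_cvgr _ _ _ _ (fun=> 0) (fun t => (beta + eta^-1) * enorm (v t))).
  - by apply: nearW => t; rewrite enorm_ge0 fb_subgradient_bound.
  - exact: cvg_cst.
  - by rewrite -(mulr0 (beta + eta^-1)); exact: (cvgM (cvg_cst _) vN).
have wu : w t @[t --> +oo] --> (0 : 'rV[R]_n).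
  apply/cvgrPdist_le => e e0.
  have H1 : \forall t \near +oo, enorm (w t) <= e by exact: (cvgr_le _ wN).
  apply: filterS H1 => t; apply: le_trans.
  by rewrite sub0r normrN norm_le_enorm.
have pN : enorm (u - p t) @[t --> +oo] --> (0 : R).
  rewrite -(@enorm0 R n) -(subrr u).
  exact: (cvg_comp _ _ (cvgB (cvg_cst u) pu) (@continuous_enorm R n _)).
pose a t := fine (f (p t)) + g (p t).
have [fno _] := f_proper.
(* The limit has finite value because all [p t] lie in the closed sublevel set at height [H 0]. *)
have [b hu] : exists b, h u = b%:E.
  have : [set y | (f y + (g y)%:E <= (H 0)%:E)%E] u.
    have clH := closed_sublevel (a := H 0) f_lsc continuous_smooth_part.
    refine (closed_cvg _ clH _ u pu).
    exists 0; split; first exact: num_real.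
    move=> t /= /ltW t0; rewrite fb_value_fin lee_fin.
    apply: le_trans (fb_energy_nonincreasing (lexx 0) t0).
    by rewrite lerDl mulr_ge0 ?sqr_ge0// invr_ge0 mulr_ge0// ltW.
  rewrite /=; case: (f u) (fno u) => [r| |]// _ _.
  by exists (r + g u).
(* A limiting subgradient needs convergence of values, which lower semicontinuity gives only from
   below. The upper bound is the subgradient inequality at [p t] tested at [u]. *)
have ab : a t @[t --> +oo] --> b.
  apply/cvgrPdist_le => e e0.
  pose q t := enorm (w t) * enorm (u - p t) +
    beta * (enorm (u - p t) * enorm (u - p t)).
  have q0 : q t @[t --> +oo] --> (0 : R).
    have -> : (0 : R) = 0 * 0 + beta * (0 * 0) by rewrite !mul0r mulr0 addr0.
    exact: (cvgD (cvgM wN pN) (cvgM (cvg_cst beta) (cvgM pN pN))).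
  have U : \forall t \near +oo, q t <= e by exact: (cvgr_le _ q0).
  have O : open [set y | ((b - e)%:E < h y)%E].
    have := closed_sublevel (a := b - e) f_lsc continuous_smooth_part.
    rewrite -openC; congr open; apply/seteqP; split=> y /=; rewrite ltNge.
      by move/negP.
    by move/negP.
  have L : \forall t \near +oo, ((b - e)%:E < h (p t))%E.
    have nu : nbhs u [set y | ((b - e)%:E < h y)%E].
      by apply: open_nbhs_nbhs; split=> //=; rewrite hu lte_fin; lra.
    exact: pu nu.
  apply: filterS (filterI U L) => t [Ut]; rewrite fb_value_fin lte_fin -/(a t) => Lt.
  have := fb_subgradient_le t u; rewrite hu lee_fin -/(a t).
  have := cauchy_schwarzN (w t) (u - p t); move: Ut; rewrite /q -expr2.
  by rewrite ler_norml; move: (edot _ _) => a1; lra.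
split; first by rewrite /edom /= hu ltry.
exists (fun k : nat => p k%:R), (fun k : nat => w k%:R); split.
- exact: (cvg_comp _ _ cvgr_idn pu).
- rewrite hu; apply: cvg_EFin.
    by apply: nearW => k /=; rewrite fb_value_fin.
  have -> : fine \o (h \o (fun k : nat => p k%:R)) = a \o (fun k : nat => k%:R).
    by apply/funext => k /=; rewrite fb_value_fin.
  exact: (cvg_comp _ _ cvgr_idn ab).
- move=> k; apply: (frechet_subdiff_of_quadratic beta_ge0 (fb_value_fin k%:R)).
  exact: fb_subgradient_le.
- exact: (cvg_comp _ _ cvgr_idn wu).
Qed.

End Trajectory.

Theorem corollary12 (R : realType) (n : nat)
  (f : 'rV[R]_n -> \bar R) (g : 'rV[R]_n -> R) (beta eta : R)
  (x0 : 'rV[R]_n) (x : R -> 'rV[R]_n)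
  (f_proper : eproper f) (f_convex : econvex f)
  (f_lsc : lower_semicontinuous f)
  (g_diff : forall y, differentiable g y)
  (beta_ge0 : 0 <= beta)
  (g_lip : forall y z, enorm (grad g y - grad g z) <= beta * enorm (y - z))
  (fg_bounded : bounded_below (fun y => (f y + (g y)%:E)%E))
  (eta_gt0 : 0 < eta)
  (eta_beta : eta * beta * (3 + eta * beta) < 1)
  (x_C1 : C1_0y x)
  (x_ode : forall t : R, 0 <= t ->
     derive0y x t + x t = prox eta f (x t - eta *: grad g (x t)))
  (x_init : x 0 = x0)
  (x_bounded : exists M : R, forall t : R, 0 <= t -> enorm (x t) <= M)
  (fg_semialg : semialgebraic_fun (fun y => (f y + (g y)%:E)%E)) :
  L1_0y (derive0y x) /\
  exists2 xbar : 'rV[R]_n,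
    crit (fun y => (f y + (g y)%:E)%E) xbar & x t @[t --> +oo] --> xbar.
Proof.
have [u xu] := trajectory_cvg f_proper f_convex f_lsc g_diff beta_ge0 g_lip
  fg_bounded eta_gt0 eta_beta x_C1 x_ode x_bounded fg_semialg.
split; last first.
  exists u => //; exact: (trajectory_cvg_crit f_proper f_convex f_lsc g_diff beta_ge0
    g_lip fg_bounded eta_gt0 eta_beta x_C1 x_ode x_bounded fg_semialg xu).
exact: (derive0y_L1 f_proper f_convex f_lsc g_diff beta_ge0 g_lip
  fg_bounded eta_gt0 eta_beta x_C1 x_ode x_bounded fg_semialg).
Qed.
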